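(* Let $k$ be any field of characteristic $p>0$ and let $$A = k[X,Y,Z,T]/(X^m Y + Z^{p^e} + T + T^{sp}),$$ where $m, e, s$ are positive integers such that $p^e \nmid sp$, $sp \nmid p^e$ and $m>1$. Then $A$ is not isomorphic, as a $k$-algebra, to the polynomial ring $k[X_1,X_2,X_3]$ in three variables over $k$.
   Context: $X,Y,Z,T$ are indeterminates over $k$. *)

(* Defs.v *)
From HB Require Import structures.
From mathcomp Require Import all_boot all_order all_algebra.
From mathcomp Require Import generic_quotient ring_quotient.
From mathcomp Require Import mpoly.
From Stdlib Require Import ClassicalDescription.

Set Implicit Arguments.
Unset Strict Implicit.
Unset Printing Implicit Defensive.

Import Order.TTheory GRing.Theory.
Local Open Scope ring_scope.
Local Open Scope quotient_scope.

Section HypersurfaceDef.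
Variables (k : fieldType) (p m e s : nat).

Definition hyp_poly : {mpoly k[4]} :=
  'X_0 ^+ m * 'X_1 + 'X_2 ^+ (p ^ e) + 'X_3 + 'X_3 ^+ (s * p).

Definition hyp_ideal : {pred {mpoly k[4]}} :=
  fun x => if excluded_middle_informative (exists q, x = q * hyp_poly)
           then true else false.

Lemma hyp_idealP x : reflect (exists q, x = q * hyp_poly) (x \in hyp_ideal).
Proof.
rewrite /in_mem /= /hyp_ideal.
by case: excluded_middle_informative => H; constructor.
Qed.

Definition hyp_zero : 'I_4 -> k :=
  fun i => if val i == 0%N then 1
           else if val i == 1%N then - ((0 : k) ^+ (p ^ e) + (0 : k) ^+ (s * p))
           else 0.

Lemma hyp_poly_root : hyp_poly.@[hyp_zero] = 0.
Proof.
rewrite /hyp_poly !mevalD mevalM !rmorphXn /= !mevalXU /hyp_zero /=.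
rewrite expr1n mul1r addr0 expr0n.
by rewrite -addrA addNr.
Qed.

Lemma hyp_ideal_closed : idealr_closed hyp_ideal.
Proof.
split.
- by apply/hyp_idealP; exists 0; rewrite mul0r.
- apply/hyp_idealP => -[q /(congr1 (meval hyp_zero))].
  by rewrite meval1 mevalM hyp_poly_root mulr0 => /eqP; rewrite oner_eq0.
- move=> a u v /hyp_idealP [qu ->] /hyp_idealP [qv ->].
  by apply/hyp_idealP; exists (a * qu + qv); rewrite mulrDl mulrA.
Qed.

HB.instance Definition _ := isIdealr.Build {mpoly k[4]} hyp_ideal
  hyp_ideal_closed.

Definition hypA := {ideal_quot (hyp_ideal : idealr _)}.

End HypersurfaceDef.

(* A k-algebra isomorphism between the quotient A and a polynomial ring:
   a bijective (unital) ring morphism compatible with the structure maps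
   from k (c |-> class of the constant c, resp. the constant c). *)
Definition kalg_iso_quot_mpoly (k : fieldType) (p m e s n : nat)
    (phi : {rmorphism hypA k p m e s -> {mpoly k[n]}}) : Prop :=
  bijective phi /\
  forall c : k, phi (\pi_(hypA k p m e s) (c%:MP : {mpoly k[4]})) = c%:MP.

(* Main.v *)
Require Import Defs.
From HB Require Import structures.
From mathcomp Require Import all_boot all_order all_algebra.
From mathcomp Require Import generic_quotient ring_quotient.
From mathcomp Require Import mpoly.
From mathcomp Require Import ring zify.
From Stdlib Require Classical_Prop.

Set Implicit Arguments.
Unset Strict Implicit.
Unset Printing Implicit Defensive.

Import Order.TTheory GRing.Theory Num.Theory.
Local Open Scope ring_scope.

(** Let x, y, z, t be the coordinate functions of A and suppose that A is a
    polynomial ring k[u_0, u_1, u_2].  The translation of u_j fixes u_i for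
    i <> j, so it is enough to show that every element fixed by a nontrivial
    exponential map Phi : A -> A[U] lies in k[x, z, t]: then A = k[x, z, t],
    which does not contain y.

    Suppose that some u outside k[x, z, t] is fixed.  Write sp = p^r q with p
    prime to q.  Give x the weight -om, y the weight m om + p^e sp, z the weight
    sp and t the weight p^e, with om large and om in 1/m + Z; give U the weight
    -w, where w is the largest slope of Phi.  The leading forms of Phi then
    define a nontrivial exponential map on x^m y + z^(p^e) + t^(sp) = 0, which
    fixes y because the leading form of u is a multiple of y.  Let d denote the
    degree in U.  Leading coefficients in U are fixed; the least positive value
    N of d is a power of p and divides all values of d; a form of nonintegral
    weight is a multiple of x.  Put g = z^(p^(e-r)) + t^q, so that
    g^(p^r) = - x^m y.

    If x is not fixed, fixed forms have integral weight.  Comparing the weights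
    of the leading coefficients of x, of g and of a form of degree N gives
    d(x) = N, d(g) = jN with j p^r = m, and m | j, which is absurd.  If x is
    fixed, so is g; then d(z) = q n and d(t) = p^(e-r) n with N | n, but every
    positive value of d is at least 2n. *)

(** * Polynomial evaluation and leading parts *)

Lemma rmorph_mmap (n : nat) (k : nzRingType) (S T : comNzRingType)
    (phi : {rmorphism S -> T}) (f : k -> S) (h : 'I_n -> S) (g : {mpoly k[n]}) :
  phi (mmap f h g) = mmap (phi \o f) (phi \o h) g.
Proof.
rewrite rmorph_sum; apply: eq_bigr => m _ /=; rewrite rmorphM rmorph_prod.
by congr (_ * _); apply: eq_bigr => i _ /=; rewrite rmorphXn.
Qed.

Lemma eq_mmap (n : nat) (k S : nzRingType) (f f' : k -> S) (h h' : 'I_n -> S)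
    (g : {mpoly k[n]}) : f =1 f' -> h =1 h' -> mmap f h g = mmap f' h' g.
Proof.
by move=> ff' hh'; apply: eq_bigr => m _; rewrite ff' (mmap1_eq _ hh').
Qed.

Section Grading.

Definition bounded (T : nmodType) (pr : rat -> T -> T) (v : rat) (a : T) :=
  forall u, v < u -> pr u a = 0.

(* Only the leading parts of a grading are required to multiply. *)
Record grading (T : comNzRingType) := Grading {
  part :> rat -> T -> T;
  partB : forall v a b, part v (a - b) = part v a - part v b;
  partM : forall u v a b, bounded part u a -> bounded part v b ->
    bounded part (u + v) (a * b) /\ part (u + v) (a * b) = part u a * part v b }.

Section Theory.
Variables (T : comNzRingType) (pr : grading T).
Implicit Types (a b : T) (u v : rat).

Lemma part0 v : pr v 0 = 0.
Proof. by rewrite -[in LHS](subrr (0 : T)) partB subrr. Qed.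

Lemma partN v a : pr v (- a) = - pr v a.
Proof. by rewrite -[in LHS](sub0r a) partB part0 sub0r. Qed.

Lemma partD v a b : pr v (a + b) = pr v a + pr v b.
Proof. by rewrite -[in LHS](opprK b) partB partN opprK. Qed.

Lemma part_sum v I (s : seq I) (P : pred I) F :
  pr v (\sum_(i <- s | P i) F i) = \sum_(i <- s | P i) pr v (F i).
Proof. exact: (big_morph _ (partD v) (part0 v)). Qed.

Lemma bounded_le u v a : u <= v -> bounded pr u a -> bounded pr v a.
Proof. by move=> uv ba w vw; apply/ba/(le_lt_trans uv). Qed.

Lemma bounded0 v : bounded pr v 0.
Proof. by move=> u _; apply: part0. Qed.

Lemma boundedD v a b : bounded pr v a -> bounded pr v b -> bounded pr v (a + b).
Proof. by move=> ba bb u vu; rewrite partD ba ?bb ?addr0. Qed.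

Lemma boundedN v a : bounded pr v a -> bounded pr v (- a).
Proof. by move=> ba u vu; rewrite partN ba ?oppr0. Qed.

Lemma bounded_sum v I (s : seq I) (P : pred I) F :
  (forall i, P i -> bounded pr v (F i)) ->
  bounded pr v (\sum_(i <- s | P i) F i).
Proof. by move=> bF; elim/big_ind: _ => //; [apply: bounded0 | apply: boundedD]. Qed.

Lemma boundedM u v a b :
  bounded pr u a -> bounded pr v b -> bounded pr (u + v) (a * b).
Proof. by move=> ba bb; case: (partM ba bb). Qed.

Lemma part_mul u v a b : bounded pr u a -> bounded pr v b ->
  pr (u + v) (a * b) = pr u a * pr v b.
Proof. by move=> ba bb; case: (partM ba bb). Qed.

Lemma part_exp v a n : bounded pr 0 1 -> pr 0 1 = 1 -> bounded pr v a ->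
  bounded pr (v *+ n) (a ^+ n) /\ pr (v *+ n) (a ^+ n) = pr v a ^+ n.
Proof.
move=> b1 p1 ba; elim: n => [|n [IHb IHp]]; first by rewrite mulr0n !expr0.
rewrite !exprS mulrS; split; first exact: boundedM.
by rewrite part_mul // IHp.
Qed.

End Theory.

(** * Gradings of multivariate polynomials by rational weights *)

Section Weight.
Variables (n : nat) (w : 'I_n -> rat).

Definition weight (m : 'X_{1..n}) : rat := \sum_i w i *+ m i.

Lemma weightD m1 m2 : weight (m1 + m2)%MM = weight m1 + weight m2.
Proof. by rewrite /weight -big_split; apply: eq_bigr => i _ /=; rewrite mnmDE mulrnDr. Qed.

Variable (k : comNzRingType).
Implicit Types (a b : {mpoly k[n]}).

Definition wpart (v : rat) a : {mpoly k[n]} :=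
  \sum_(m <- msupp a | weight m == v) a@_m *: 'X_[m].

Lemma mcoeff_wpart v a m : (wpart v a)@_m = a@_m *+ (weight m == v).
Proof.
rewrite /wpart raddf_sum /= big_mkcond /=.
have [ma|ma] := boolP (m \in msupp a); last first.
  rewrite (memN_msupp_eq0 ma) mul0rn big1_seq // => m' /andP[_ m'a].
  case: ifP => // _; rewrite mcoeffZ mcoeffX.
  by case: eqP m'a ma => [-> ->|]; rewrite ?mulr0.
rewrite (bigD1_seq m) ?msupp_uniq //= big1 => [|m' m'm]; last first.
  by case: ifP => // _; rewrite mcoeffZ mcoeffX (negPf m'm) mulr0.
by case: eqP; rewrite addr0 // mcoeffZ mcoeffX eqxx mulr1.
Qed.

Lemma wpartB v a b : wpart v (a - b) = wpart v a - wpart v b.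
Proof. by apply/mpolyP => m; rewrite mcoeffB !mcoeff_wpart mcoeffB mulrnBl. Qed.

Lemma wboundedP v a :
  bounded wpart v a <-> (forall m, m \in msupp a -> weight m <= v).
Proof.
split=> [ba m ma|ba u vu].
  rewrite leNgt; apply/negP => /ba /(congr1 (mcoeff m)).
  by rewrite mcoeff_wpart eqxx mcoeff0; apply/eqP; rewrite -mcoeff_msupp.
apply/mpolyP => m; rewrite mcoeff_wpart mcoeff0; case: eqP => // wm.
by apply/eqP; rewrite mcoeff_eq0; apply: contraTN vu => /ba; rewrite wm -leNgt.
Qed.

Lemma wpartZX v (c : k) m :
  wpart v (c *: 'X_[m]) = (c *: 'X_[m]) *+ (weight m == v).
Proof.
apply/mpolyP => m'; rewrite mcoeff_wpart mcoeffMn mcoeffZ mcoeffX.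
by have [->|] := eqVneq m m'; rewrite ?mulr0 ?mul0rn.
Qed.

Lemma wpart_sum v I (s : seq I) (P : pred I) F :
  wpart v (\sum_(i <- s | P i) F i) = \sum_(i <- s | P i) wpart v (F i).
Proof.
apply/mpolyP => m; rewrite mcoeff_wpart !raddf_sum /= -sumrMnl.
by apply: eq_bigr => i _; rewrite mcoeff_wpart.
Qed.

Lemma wpartM u v a b : bounded wpart u a -> bounded wpart v b ->
  bounded wpart (u + v) (a * b) /\ wpart (u + v) (a * b) = wpart u a * wpart v b.
Proof.
move=> /wboundedP ba /wboundedP bb.
have wM x : wpart x (a * b) = \sum_(i <- msupp a) \sum_(j <- msupp b)
    (a@_i * b@_j *: 'X_[i + j]) *+ (weight i + weight j == x).
  rewrite {1}[a]mpolyE {1}[b]mpolyE mulr_suml wpart_sum.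
  apply: eq_bigr => i _; rewrite mulr_sumr wpart_sum; apply: eq_bigr => j _.
  by rewrite -scalerAr -scalerAl scalerA -mpolyXD wpartZX weightD mulrC.
split=> [x uvx|].
  rewrite wM big_seq big1 // => i ia; rewrite big_seq big1 // => j jb.
  by case: eqP => // wx; move: (lerD (ba _ ia) (bb _ jb)); rewrite wx leNgt uvx.
rewrite wM /wpart mulr_suml [RHS]big_mkcond big_seq [RHS]big_seq /=.
apply: eq_bigr => i ia; rewrite mulr_sumr.
case: eqP => [wi|wi]; last first.
  rewrite big_seq big1 // => j jb; case: eqP => // wij; case: wi.
  apply/eqP; rewrite eq_le ba //= -(lerD2r (weight j)) wij lerD2l.
  exact: bb.
rewrite [RHS]big_mkcond; apply: eq_bigr => j jb.
rewrite wi (inj_eq (addrI u)); case: eqP => //= _.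
by rewrite -scalerAr -scalerAl scalerA -mpolyXD mulrC.
Qed.

Definition wgrading : grading {mpoly k[n]} := Grading wpartB wpartM.

Lemma wpart_neq0 v a m : m \in msupp a -> weight m = v -> wpart v a != 0.
Proof.
move=> ma wm; apply: contraTneq ma => /(congr1 (mcoeff m)).
by rewrite mcoeff_wpart wm eqxx mcoeff0 => /eqP; rewrite mcoeff_eq0.
Qed.

Lemma wdeg_exists a : a != 0 ->
  exists v, bounded wpart v a /\ exists2 m, m \in msupp a & weight m = v.
Proof.
rewrite -msupp_eq0.
suff: forall t : seq 'X_{1..n}, t != [::] ->
    exists2 m, m \in t & forall m', m' \in t -> weight m' <= weight m.
  by move=> H /H [m ma mm]; exists (weight m); split; [apply/wboundedP|exists m].
elim=> // m [_ _|m' t IH _]; first by exists m => [|m']; rewrite inE ?eqxx // => /eqP->.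
have [//|m0 m0t mm0] := IH.
have [le_m|lt_m] := leP (weight m) (weight m0).
  by exists m0 => [|m1]; rewrite inE ?m0t ?orbT // => /orP[/eqP->|/mm0].
exists m; rewrite ?mem_head // => m1; rewrite inE => /orP[/eqP->//|/mm0 h].
exact: le_trans h (ltW lt_m).
Qed.

Lemma msupp_wpart v a m : m \in msupp (wpart v a) -> m \in msupp a /\ weight m = v.
Proof.
rewrite !mcoeff_msupp mcoeff_wpart; by case: (weight m =P v); rewrite ?mulr0n ?eqxx.
Qed.

End Weight.

(** * Leading parts of evaluated polynomials *)

Section Deform.
Variables (k T : comNzRingType) (pr : grading T) (f : {rmorphism k -> T}).
Hypothesis f_bounded : forall c, bounded pr 0 (f c).
Hypothesis f_part : forall c, pr 0 (f c) = f c.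
Variables (n : nat) (w : 'I_n -> rat) (h : 'I_n -> T).
Hypothesis h_bounded : forall i, bounded pr (w i) (h i).
Let h0 i := pr (w i) (h i).

Let one_bounded : bounded pr 0 1. Proof. by rewrite -(rmorph1 f). Qed.
Let one_part : pr 0 1 = 1. Proof. by rewrite -(rmorph1 f). Qed.

Lemma mmap1_part m : bounded pr (weight w m) (mmap1 h m) /\
  pr (weight w m) (mmap1 h m) = mmap1 h0 m.
Proof.
rewrite /weight /mmap1.
elim/big_ind3: _ => [|x1 a1 b1 x2 a2 b2 [B1 P1] [B2 P2]|i _]; first by [].
  by rewrite -P1 -P2; apply: partM.
exact: part_exp.
Qed.

(** Each monomial of [g] evaluates to something bounded by its own weight, with multiplicative
    leading part; in weight [v] only the monomials of weight exactly [v] survive. *)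
Lemma mmap_part v (g : {mpoly k[n]}) : bounded (wpart w (k := k)) v g ->
  bounded pr v (mmap f h g) /\ pr v (mmap f h g) = mmap f h0 (wpart w v g).
Proof.
move=> /wboundedP bg.
have mono m c : bounded pr (weight w m) (f c * mmap1 h m) /\
    pr (weight w m) (f c * mmap1 h m) = f c * mmap1 h0 m.
  have [B P] := mmap1_part m.
  by rewrite -[weight w m]add0r -P -[in RHS]f_part; apply: partM.
split.
  rewrite /mmap big_seq; apply: bounded_sum => m ma.
  by apply: bounded_le (bg _ ma) _; case: (mono m g@_m).
rewrite /mmap part_sum -/(mmap f h0 _) /wpart raddf_sum [RHS]big_mkcond.
rewrite big_seq [RHS]big_seq; apply: eq_bigr => m ma.
have [B P] := mono m g@_m.
case: eqP => [<-|/eqP wv]; first by rewrite /= P mmapZ mmapX.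
by rewrite B // lt_neqAle wv bg.
Qed.

End Deform.

Section PolyGrading.
Variables (T : comNzRingType) (pr : grading T) (w : rat).
Implicit Types (f g : {poly T}).

(* The indeterminate of [{poly T}] has weight [- w]. *)
Definition ppart (v : rat) f : {poly T} :=
  \poly_(i < size f) pr (v + w *+ i) f`_i.

Lemma coef_ppart v f i : (ppart v f)`_i = pr (v + w *+ i) f`_i.
Proof.
by rewrite coef_poly; case: ltnP => // /(nth_default 0) ->; rewrite part0.
Qed.

Lemma ppartB v f g : ppart v (f - g) = ppart v f - ppart v g.
Proof. by apply/polyP => i; rewrite coefB !coef_ppart coefB partB. Qed.

Lemma pboundedP v f :
  bounded ppart v f <-> (forall i, bounded pr (v + w *+ i) f`_i).
Proof.
split=> [bf i u vu|bf u vu]; last first.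
  by apply/polyP => i; rewrite coef_ppart coef0 bf // ltrD2r.
have := bf (u - w *+ i); rewrite ltrBrDr => /(_ vu) /polyP /(_ i).
by rewrite coef_ppart subrK coef0.
Qed.

Lemma ppartM u v f g : bounded ppart u f -> bounded ppart v g ->
  bounded ppart (u + v) (f * g) /\ ppart (u + v) (f * g) = ppart u f * ppart v g.
Proof.
move=> /pboundedP bf /pboundedP bg.
have e n (i : 'I_n.+1) : u + v + w *+ n = (u + w *+ i) + (v + w *+ (n - i)).
  by rewrite addrACA -mulrnDr subnKC // -ltnS.
split.
  apply/pboundedP => n; rewrite coefM; apply: bounded_sum => i _.
  by rewrite (e n i); apply: boundedM.
apply/polyP => n; rewrite coef_ppart !coefM part_sum; apply: eq_bigr => i _.
by rewrite (e n i) part_mul // !coef_ppart.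
Qed.

Definition pgrading : grading {poly T} := Grading ppartB ppartM.

End PolyGrading.

End Grading.

(** * Translations *)

Lemma coef_comp_XaddY (R : comNzRingType) (f : {poly R}) (i l : nat) :
  ((map_poly (polyC \o polyC) f).['X + 'Y])`_l`_i = f`_(i + l) *+ 'C(i + l, i).
Proof.
have cXX (t : nat) : (('X + 'Y) ^+ t : {poly {poly R}})`_l`_i =
    ((t == i + l)%N%:R : R) *+ 'C(t, i).
  rewrite exprDn !coef_sum.
  rewrite (eq_bigr (fun b : 'I_t.+1 =>
      ((t - b == l)%N && (b == i :> nat))%:R *+ 'C(t, b))) => [|b _].
    have [it|it] := ltnP i t.+1; last first.
      rewrite (bin_small it) mulr0n big1 // => b _.
      by rewrite (ltn_eqF (leq_trans (ltn_ord b) it)) andbF mul0rn.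
    rewrite (bigD1 (Ordinal it)) //= big1 => [|b /negPf bi].
      by rewrite eqxx andbT addr0 -(eqn_add2l i) subnKC.
    by rewrite -[b == i :> nat]/(b == Ordinal it) bi andbF mul0rn.
  rewrite coefMn -rmorphXn /= coefMC coefXn coefMn.
  by rewrite eq_sym; case: eqP => _; rewrite ?mul1r ?mul0r ?coef0 // coefXn eq_sym.
have -> : map_poly (polyC \o polyC) f = \sum_(t < size f) (f`_t)%:P%:P *: 'X^t.
  by rewrite -{1}[f]coefK poly_def rmorph_sum; apply: eq_bigr => t _;
    rewrite /= map_polyZ map_polyXn.
rewrite horner_sum !coef_sum (eq_bigr (fun t : 'I_(size f) =>
    f`_t * ((t == i + l :> nat)%N%:R *+ 'C(t, i)))) => [|t _]; last first.
  by rewrite hornerZ hornerXn !coefCM cXX.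
have [lt|le] := ltnP (i + l) (size f); last first.
  rewrite [f`_(i + l)]nth_default // mul0rn big1 // => t _.
  by rewrite (ltn_eqF (leq_trans (ltn_ord t) le)) mul0rn mulr0.
rewrite (bigD1 (Ordinal lt)) //= eqxx mulrnAr mulr1 big1 ?addr0 // => t /negPf ne.
by rewrite -[_ == _ :> nat]/(t == Ordinal lt) ne mul0rn mulr0.
Qed.

Section Translation.
Variables (k : comNzRingType) (n : nat) (j : 'I_n).
Local Notation P := {mpoly k[n]}.
Variable tau : {rmorphism P -> {poly P}}.
Hypothesis tauC : forall c, tau c%:MP = c%:MP%:P.
Hypothesis tauX : forall i, tau 'X_i = ('X_i)%:P + 'X *+ (i == j).

Lemma tauE (a : P) :
  tau a = mmap (polyC \o @mpolyC n k) (fun i => ('X_i)%:P + 'X *+ (i == j)) a.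
Proof.
rewrite {1}[a]mpolyE rmorph_sum; apply: eq_bigr => m _ /=.
rewrite -mul_mpolyC rmorphM tauC mpolyXE_id rmorph_prod; congr (_ * _).
by apply: eq_bigr => i _; rewrite rmorphXn /= tauX.
Qed.

Lemma translation_coef0 (a : P) : (tau a)`_0 = a.
Proof.
rewrite -horner_coef0 -/(horner_eval 0 _) tauE rmorph_mmap.
rewrite (eq_mmap (f' := @mpolyC n k) (h' := fun i => 'X_i)) => [|c|i] /=.
- rewrite -[RHS]comp_mpoly_id; apply: eq_mmap => // i.
  by rewrite tnth_map tnth_ord_tuple.
- by rewrite /horner_eval hornerC.
- by rewrite /horner_eval hornerD hornerMn hornerX hornerC mul0rn addr0.
Qed.

(** Coefficientwise form of the law that translating by [U] and then by [V] is translating by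
    [U + V]. Both sides of that law are ring morphisms in [a], so it is checked on constants and
    variables. *)
Lemma translation_iter (a : P) (i l : nat) :
  (tau (tau a)`_l)`_i = (tau a)`_(i + l) *+ 'C(i + l, i).
Proof.
rewrite -coef_comp_XaddY.
pose ev : {rmorphism {poly P} -> {poly {poly P}}} :=
  (horner_eval ('X + 'Y)) \o (map_poly (polyC \o polyC)).
transitivity (map_poly tau (tau a))`_l`_i; first by rewrite (coef_map tau).
suff -> : map_poly tau (tau a) = ev (tau a) by [].
rewrite !(tauE a) !rmorph_mmap; apply: eq_mmap => [c|i'] /=.
  by rewrite map_polyC /= tauC map_polyC /horner_eval hornerC.
rewrite !rmorphD !rmorphMn /= !map_polyC !map_polyX /= tauX /horner_eval.
by rewrite rmorphD rmorphMn /= hornerC hornerX mulrnDl addrA addrAC.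
Qed.

End Translation.

Lemma translation_exists (k : comNzRingType) (n : nat) (j : 'I_n) :
  exists tau : {rmorphism {mpoly k[n]} -> {poly {mpoly k[n]}}},
    (forall c, tau c%:MP = c%:MP%:P) /\
    (forall i, tau 'X_i = ('X_i)%:P + 'X *+ (i == j)).
Proof.
exists (mmap (polyC \o @mpolyC n k) (fun i => ('X_i)%:P + 'X *+ (i == j))).
by split=> [c|i]; [rewrite /= mmapC | rewrite /= mmapX mmap1U].
Qed.

(** * Coordinates of the hypersurface *)

Section Homogeneous.
Variables (n : nat) (w : 'I_n -> rat) (k : comNzRingType).
Local Notation wp := (wpart w (k := k)).

Lemma wpartD v (a b : {mpoly k[n]}) : wp v (a + b) = wp v a + wp v b.
Proof. exact: (@partD _ (wgrading w k)). Qed.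

Lemma wpartN v (a : {mpoly k[n]}) : wp v (- a) = - wp v a.
Proof. exact: (@partN _ (wgrading w k)). Qed.

Definition whomog (v : rat) (a : {mpoly k[n]}) := bounded wp v a /\ wp v a = a.

Lemma whomogX m : whomog (weight w m) 'X_[m].
Proof.
split; first by apply/wboundedP => m'; rewrite msuppX inE => /eqP ->.
by rewrite -['X_[m]]scale1r wpartZX eqxx.
Qed.

Lemma weightU i : weight w U_(i) = w i.
Proof.
rewrite /weight (bigD1 i) //= mnm1E eqxx big1 ?addr0 // => j ji.
by rewrite mnm1E eq_sym (negPf ji).
Qed.

Lemma whomogXU i : whomog (w i) 'X_i.
Proof. by rewrite -weightU; apply: whomogX. Qed.

Lemma whomogC c : whomog 0 c%:MP.
Proof.
have -> : c%:MP_[n] = c *: 'X_[0%MM] by rewrite mpolyX0 -mul_mpolyC mulr1.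
have w0 : weight w 0%MM = 0 by rewrite /weight big1 // => i _; rewrite mnm0E.
split; last by rewrite wpartZX w0 eqxx.
apply/wboundedP => m; have [->|c0] := eqVneq c 0.
  by rewrite scale0r msupp0.
by rewrite msuppMCX // inE => /eqP ->; rewrite w0.
Qed.

Lemma whomogM u v a b : whomog u a -> whomog v b -> whomog (u + v) (a * b).
Proof. by case=> ba pa [bb pb]; rewrite /whomog -{3}pa -{3}pb; apply: wpartM. Qed.

Lemma whomog_exp v a i : whomog v a -> whomog (v *+ i) (a ^+ i).
Proof.
move=> ha; elim: i => [|i IH]; first by rewrite mulr0n expr0 -mpolyC1; apply: whomogC.
by rewrite exprS mulrS; apply: whomogM.
Qed.

Lemma whomogD v a b : whomog v a -> whomog v b -> whomog v (a + b).
Proof.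
case=> ba pa [bb pb]; split; first exact: (@boundedD _ (wgrading w k)).
by rewrite wpartD pa pb.
Qed.

Lemma whomogN v a : whomog v a -> whomog v (- a).
Proof.
case=> ba pa; split; first exact: (@boundedN _ (wgrading w k)).
by rewrite wpartN pa.
Qed.

Lemma leading_part v u a b : whomog v a -> bounded wp u b -> u < v ->
  bounded wp v (a + b) /\ wp v (a + b) = a.
Proof.
case=> ba pa bb uv; split.
  apply: (@boundedD _ (wgrading w k)) => //.
  exact: (@bounded_le _ (wgrading w k) u v b (ltW uv)).
by rewrite wpartD pa (bb v uv) addr0.
Qed.

End Homogeneous.

Definition pt3 (T : Type) (a b c : T) : 'I_3 -> T := fun i => nth a [:: a; b; c] i.
Definition pt4 (T : Type) (a b c d : T) : 'I_4 -> T := fun i => nth a [:: a; b; c; d] i.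

Lemma forall_ord3 (P : 'I_3 -> Prop) : P 0 -> P 1 -> P 2 -> forall i, P i.
Proof.
move=> P0 P1 P2 [[|[|[|//]]] lt]; set i := Ordinal lt.
- by have -> : i = 0 by apply: val_inj.
- by have -> : i = 1 by apply: val_inj.
- by have -> : i = 2 by apply: val_inj.
Qed.

Lemma forall_ord4 (P : 'I_4 -> Prop) : P 0 -> P 1 -> P 2 -> P 3 -> forall i, P i.
Proof.
move=> P0 P1 P2 P3 [[|[|[|[|//]]]] lt]; set i := Ordinal lt.
- by have -> : i = 0 by apply: val_inj.
- by have -> : i = 1 by apply: val_inj.
- by have -> : i = 2 by apply: val_inj.
- by have -> : i = 3 by apply: val_inj.
Qed.

Lemma big_ord4 (R : Type) (idx : R) (op : Monoid.law idx) (F : 'I_4 -> R) :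
  \big[op/idx]_(i < 4) F i = op (op (op (F 0) (F 1)) (F 2)) (F 3).
Proof.
rewrite !big_ord_recr big_ord0 Monoid.mul1m.
by congr (op (op (op _ _) _) _); congr F; apply: val_inj.
Qed.

Lemma mmap1_pt4 (R : comNzRingType) (a b c d : R) (m : 'X_{1..4}) :
  mmap1 (pt4 a b c d) m = a ^+ m 0 * b ^+ m 1 * c ^+ m 2 * d ^+ m 3.
Proof. by rewrite /mmap1 big_ord4. Qed.

Lemma weight_pt4 (a b c d : rat) (m : 'X_{1..4}) :
  weight (pt4 a b c d) m = a *+ m 0 + b *+ m 1 + c *+ m 2 + d *+ m 3.
Proof. by rewrite /weight big_ord4. Qed.

Section Coordinates.
Variables (k : fieldType) (Q S m : nat).
Local Notation E := {mpoly k[3]}.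
Local Notation M := {mpoly k[4]}.

(* Adjoining [Q]-th roots of x, y and t makes z a polynomial, so that the
   hypersurface ring embeds into a polynomial ring. *)
Definition coord_root : 'I_4 -> E :=
  pt4 ('X_0 ^+ Q) ('X_1 ^+ Q) (- ('X_2 ^+ S + 'X_0 ^+ m * 'X_1 + 'X_2)) ('X_2 ^+ Q).

(** Leading forms of [coord_root] for [root_wt]: only the linear term in t disappears. *)
Definition coord_top : 'I_4 -> E :=
  pt4 ('X_0 ^+ Q) ('X_1 ^+ Q) (- ('X_2 ^+ S + 'X_0 ^+ m * 'X_1)) ('X_2 ^+ Q).

(** A second degeneration, obtained by weighting ['X_1] alone, after which every coordinate is a
    monomial up to sign. *)
Definition coord_mon : 'I_4 -> E :=
  pt4 ('X_0 ^+ Q) ('X_1 ^+ Q) (- ('X_0 ^+ m * 'X_1)) ('X_2 ^+ Q).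

Definition root_wt (om : rat) : 'I_3 -> rat :=
  pt3 (- om / Q%:R) ((om *+ m + (Q * S)%:R) / Q%:R) 1.

Definition coord_wt (om : rat) : 'I_4 -> rat :=
  pt4 (- om) (om *+ m + (Q * S)%:R) S%:R Q%:R.

Hypotheses (Q0 : (0 < Q)%N) (S1 : (1 < S)%N).

Let Qr : (Q%:R : rat) != 0. Proof. by rewrite pnatr_eq0 -lt0n. Qed.

(** The weights make the roots of x^m y and of t^S both of weight [S], while the remaining summand
    ['X_2] of z has weight 1 < [S]. *)
Lemma coord_part om i : bounded (wpart (root_wt om) (k := k)) (coord_wt om i) (coord_root i) /\
  wpart (root_wt om) (coord_wt om i) (coord_root i) = coord_top i.
Proof.
have hX j : whomog (root_wt om) (root_wt om j) ('X_j : E) by apply: whomogXU.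
have hXQ j v : v = root_wt om j *+ Q -> whomog (root_wt om) v ('X_j ^+ Q : E).
  by move=> ->; apply: whomog_exp.
have hS : whomog (root_wt om) S%:R ('X_2 ^+ S : E) by have := whomog_exp S (hX 2).
have hXY : whomog (root_wt om) S%:R ('X_0 ^+ m * 'X_1 : E).
  have := whomogM (whomog_exp m (hX 0)) (hX 1); rewrite /root_wt /pt3 /=.
  suff -> : (- om / Q%:R) *+ m + (om *+ m + (Q * S)%:R) / Q%:R = S%:R :> rat by [].
  by rewrite -[_ *+ m]mulr_natr -[om *+ m]mulr_natr natrM; field; exact: Qr.
move: i; apply: forall_ord4; rewrite /coord_root /coord_wt /coord_top /pt4 /=.
- by apply: (hXQ 0); rewrite /root_wt /pt3 /= -mulr_natr; field; exact: Qr.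
- by apply: (hXQ 1); rewrite /root_wt /pt3 /= -mulr_natr; field; exact: Qr.
- rewrite opprD; apply: (@leading_part _ _ _ _ 1); last by rewrite ltr1n.
    by apply: whomogN; apply: whomogD.
  by case: (whomogN (hX 2)).
- by apply: (hXQ 2); rewrite /root_wt /pt3.
Qed.

Let w1 : 'I_3 -> rat := pt3 0 1 0.
Let w2 : 'I_4 -> rat := pt4 0 Q%:R 1 0.

Lemma coord_top_part i : bounded (wpart w1 (k := k)) (w2 i) (coord_top i) /\
  wpart w1 (w2 i) (coord_top i) = coord_mon i.
Proof.
have hX j : whomog w1 (w1 j) ('X_j : E) by apply: whomogXU.
have hXQ j v : v = w1 j *+ Q -> whomog w1 v ('X_j ^+ Q : E).
  by move=> ->; apply: whomog_exp.
have hXY : whomog w1 1 ('X_0 ^+ m * 'X_1 : E).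
  by have := whomogM (whomog_exp m (hX 0)) (hX 1); rewrite /w1 /pt3 /= mul0rn add0r.
have hS : whomog w1 0 ('X_2 ^+ S : E).
  by have := whomog_exp S (hX 2); rewrite /w1 /pt3 /= mul0rn.
move: i; apply: forall_ord4; rewrite /coord_mon /w2 /coord_top /pt4 /=.
- by apply: (hXQ 0); rewrite mul0rn.
- by apply: (hXQ 1).
- rewrite addrC opprD; apply: (@leading_part _ _ _ _ 0) => //; first exact: whomogN.
  by case: (whomogN hS).
- by apply: (hXQ 2); rewrite mul0rn.
Qed.

(** Normal forms modulo the hypersurface: the relation eliminates the [Q]-th power of z. *)
Definition reduced (g : M) := forall a, a \in msupp g -> (a 2%R < Q)%N.

Lemma reduced_wpart w v g : reduced g -> reduced (wpart w v g).
Proof. by move=> rg a /msupp_wpart[/rg]. Qed.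

Let emon (a : 'X_{1..4}) : 'X_{1..3} :=
  [multinom pt3 (Q * a 0%R + m * a 2%R)%N (Q * a 1%R + a 2%R)%N (Q * a 3%R)%N i | i < 3].

Lemma mmap1_coord_mon a : mmap1 coord_mon a = (-1) ^+ a 2 *: 'X_[emon a].
Proof.
rewrite mmap1_pt4 (exprNn ('X_0 ^+ m * 'X_1)) -!exprM -mul_mpolyC (rmorphXn (@mpolyC 3 k)) rmorphN1.
rewrite (mpolyXE_id k (emon a)) !big_ord_recl big_ord0 mulr1 !mnmE /=.
have -> : lift ord0 ord0 = 1 :> 'I_3 by apply: val_inj.
have -> : lift ord0 (lift ord0 ord0) = 2 :> 'I_3 by apply: val_inj.
rewrite /pt3 /= !exprD exprMn -exprM.
by ring.
Qed.

(** The exponent of ['X_1] modulo [Q] recovers the exponent of z, which is below [Q]; the other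
    exponents follow. *)
Lemma emon_inj (a b : 'X_{1..4}) : (a 2%R < Q)%N -> (b 2%R < Q)%N -> emon a = emon b -> a = b.
Proof.
move=> aQ bQ /mnmP e; apply/mnmP.
have e0 := e 0; have e1 := e 1; have e2 := e 2; move: e0 e1 e2.
rewrite !mnmE /pt3 /= => e0 e1 /eqP; rewrite eqn_pmul2l // => /eqP e3.
have e2 : a 2 = b 2.
  by move: (congr1 (modn^~ Q) e1); rewrite !(mulnC Q) !modnMDl !modn_small.
move: e0 e1; rewrite e2 => /eqP; rewrite eqn_add2r eqn_pmul2l // => /eqP e0.
move=> /eqP; rewrite eqn_add2r eqn_pmul2l // => /eqP e1.
exact: forall_ord4.
Qed.

(** By [emon_inj], distinct reduced monomials have distinct monomial images, so nothing cancels. *)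
Lemma reduced_coord_mon_neq0 g : g != 0 -> reduced g ->
  mmap (@mpolyC 3 k) coord_mon g != 0.
Proof.
move=> g0 rg; have : msupp g != [::] by rewrite msupp_eq0.
case E : (msupp g) => [//|a t] _; have ag : a \in msupp g by rewrite E mem_head.
apply: contraTneq (ag) => /(congr1 (mcoeff (emon a))) /eqP.
rewrite /mmap raddf_sum /= (bigD1_seq a) ?msupp_uniq //= big_seq_cond big1 => [|b].
  rewrite mul_mpolyC mmap1_coord_mon addr0 !mcoeffZ mcoeffX eqxx mulr1.
  by rewrite mcoeff0 mulf_eq0 signr_eq0 orbF mcoeff_eq0.
case/andP=> bg ba; rewrite mul_mpolyC mmap1_coord_mon !mcoeffZ mcoeffX.
case: eqP => [/emon_inj e|_]; last by rewrite !mulr0.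
by rewrite e ?eqxx ?rg // in ba.
Qed.

(** The leading part of the value at [coord_top] is the value at [coord_mon] of a leading form of
    [g], which is again reduced. *)
Lemma reduced_coord_top_neq0 g : g != 0 -> reduced g ->
  mmap (@mpolyC 3 k) coord_top g != 0.
Proof.
move=> g0 rg; have [v [bv [a ag av]]] := wdeg_exists w2 g0.
have := @mmap_part _ _ (wgrading w1 k) (@mpolyC 3 k) _ _ _ w2 coord_top _ v g bv.
case.
- by move=> c; case: (whomogC w1 c).
- by move=> c; case: (whomogC w1 c).
- by move=> i; case: (coord_top_part i).
move=> _ e; have := reduced_coord_mon_neq0 (wpart_neq0 ag av) (reduced_wpart rg).
apply: contraNneq => e0; apply/eqP.
rewrite e0 (part0 (wgrading w1 k)) in e; rewrite [RHS]e.
by apply: eq_mmap => // i; case: (coord_top_part i).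
Qed.

Lemma coord_mmap_part om v (g : M) : bounded (wpart (coord_wt om) (k := k)) v g ->
  bounded (wpart (root_wt om) (k := k)) v (mmap (@mpolyC 3 k) coord_root g) /\
  wpart (root_wt om) v (mmap (@mpolyC 3 k) coord_root g) =
    mmap (@mpolyC 3 k) coord_top (wpart (coord_wt om) v g).
Proof.
move=> bg.
have := @mmap_part _ _ (wgrading (root_wt om) k) (@mpolyC 3 k) _ _ _
  (coord_wt om) coord_root _ v g bg.
case.
- by move=> c; case: (whomogC (root_wt om) c).
- by move=> c; case: (whomogC (root_wt om) c).
- by move=> i; case: (coord_part om i).
move=> B e; split=> //; rewrite [LHS]e.
by apply: eq_mmap => // i; case: (coord_part om i).
Qed.

End Coordinates.

(** Comparing coefficients in (X + 1)^(p^i l) = (X^(p^i) + 1)^l shows that the binomial is congruent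
    to [l] modulo [p]. *)
Lemma pchar_bin_pow_neq0 (R : idomainType) (p i l : nat) : p \in [pchar R] ->
  ~~ (p %| l)%N -> 'C(p ^ i * l, p ^ i)%:R != 0 :> R.
Proof.
move=> Rp pl; have p_pr := pcharf_prime Rp.
have pP : p \in [pchar {poly R}] by rewrite pchar_poly.
have pi0 : (0 < p ^ i)%N by rewrite expn_gt0 prime_gt0.
have e : ('X + 1) ^+ (p ^ i * l) = ('X^(p ^ i) + 1) ^+ l :> {poly R}.
  rewrite exprM exprDn_pchar ?expr1n // pnatX; apply/orP; left.
  by rewrite pnatE.
have cD n j : (('X + 1) ^+ n : {poly R})`_j = 'C(n, j)%:R.
  rewrite exprDn coef_sum; have [jn|nj] := ltnP j n.+1; last first.
    rewrite bin_small // big1 // => b _; rewrite coefMn expr1n mulr1 coefXn.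
    by rewrite gtn_eqF ?mul0rn // (leq_ltn_trans (leq_subr _ _)).
  rewrite (bigD1 (rev_ord (Ordinal jn))) //= subSS subKn // expr1n mulr1.
  rewrite coefMn coefXn eqxx bin_sub // big1 ?addr0 // => b.
  rewrite -val_eqE /= subSS => bj; rewrite expr1n mulr1 coefMn coefXn.
  have bn : (b <= n)%N by rewrite -ltnS.
  case: eqP => jb; last by rewrite mul0rn.
  by rewrite jb subKn ?eqxx in bj.
have := congr1 (fun f : {poly R} => f`_(p ^ i)) e.
rewrite /= cD => ->; rewrite -['X^(p ^ i) + 1]/('X^(p ^ i) + 1%:P).
have -> : ('X^(p ^ i) + 1%:P) ^+ l = (('X + 1) ^+ l \Po 'X^(p ^ i)) :> {poly R}.
  by rewrite rmorphXn rmorphD /= comp_polyX comp_polyC.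
rewrite coef_comp_poly_Xn // dvdnn divnn pi0 cD bin1.
by rewrite -(dvdn_pcharf Rp).
Qed.

Lemma size_sum_distinct (R : nzRingType) (n : nat) (f : nat -> {poly R}) :
  (forall i j, (i < n)%N -> (j < n)%N -> f i != 0 -> f j != 0 ->
     size (f i) = size (f j) -> i = j) ->
  \sum_(i < n) f i = 0 \/
  exists i, [/\ (i < n)%N, f i != 0 & size (\sum_(i < n) f i) = size (f i)].
Proof.
elim: n => [|n IH] inj; first by left; rewrite big_ord0.
rewrite big_ord_recr /=.
have [i j il jl|s0|[i [il fi0 si]]] := IH.
- by apply: inj; apply: ltnW.
- rewrite s0 add0r; have [->|fn0] := eqVneq (f n) 0; first by left.
  by right; exists n.
have [fn0|fn0] := eqVneq (f n) 0.
  by right; exists i; rewrite fn0 addr0 ltnW.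
right; case: (ltngtP (size (f i)) (size (f n))) => lt.
- by exists n; rewrite addrC size_polyDl ?si.
- by exists i; rewrite size_polyDl ?si // ltnW.
- have e := inj i n (ltnW il) (ltnSn n) fi0 fn0 lt.
  by move: il; rewrite e ltnn.
Qed.

(** * Polynomial parametrisations of the curve z^al + t^q = c *)

Section CuspCurve.
Variables (R : idomainType) (Z T : {poly R}) (c : R) (al q n : nat).
Hypotheses (al1 : (1 < al)%N) (q1 : (1 < q)%N) (n0 : (0 < n)%N).
Hypothesis alq : coprime al q.
Hypothesis ZT : Z ^+ al = c%:P - T ^+ q.
Hypotheses (sZ : size Z = (q * n).+1) (sT : size T = (al * n).+1).

(** The span of 1, Z, ..., Z^(al-1) over the polynomials in [T]; it contains every polynomial in [Z]
    and [T]. *)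
Let V (f : {poly R}) :=
  exists cs : nat -> {poly R}, f = \sum_(j < al) (cs j \Po T) * Z ^+ j.

Let V_add f g : V f -> V g -> V (f + g).
Proof.
move=> [cs ->] [ds ->]; exists (fun j => cs j + ds j); rewrite -big_split.
by apply: eq_bigr => j _; rewrite /= rmorphD mulrDl.
Qed.

Let V_comp d f : V f -> V ((d \Po T) * f).
Proof.
move=> [cs ->]; exists (fun j => d * cs j); rewrite mulr_sumr.
by apply: eq_bigr => j _; rewrite rmorphM mulrA.
Qed.

Let V_const d : V d%:P.
Proof.
exists (fun j => if j is 0 then d%:P else 0); case: al al1 => // a _.
rewrite big_ord_recl big1 ?addr0 => [|j _]; first by rewrite comp_polyC expr0 mulr1.
by rewrite /= rmorph0 mul0r.
Qed.

(** The top term becomes [Z ^+ al], which [ZT] rewrites as a polynomial in [T] and moves to index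
    0. *)
Let V_Z f : V f -> V (Z * f).
Proof.
move=> [cs ->]; rewrite /V; case: al al1 ZT => // a _ ZTa.
exists (fun j => if j is j'.+1 then cs j' else cs a * (c%:P - 'X^q)).
rewrite mulr_sumr big_ord_recr big_ord_recl /= addrC; congr (_ + _).
  rewrite mulrCA -exprS ZTa rmorphM rmorphB rmorphXn /= comp_polyC comp_polyX.
  by rewrite expr0 mulr1.
by apply: eq_bigr => j _; rewrite mulrCA -exprS.
Qed.

(* The products [Z ^ j * T ^ i] with [j < al] have pairwise distinct degrees. *)
Lemma cusp_span_size I (s : seq I) (F : I -> R) (a b : I -> nat) f :
  f = \sum_(i <- s) (F i)%:P * Z ^+ a i * T ^+ b i ->
  (size f <= 1)%N \/ (2 * n < size f)%N.
Proof.
move=> ->; have : V (\sum_(i <- s) (F i)%:P * Z ^+ a i * T ^+ b i).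
  elim/big_ind: _ => [||i _]; [exact: (V_const 0)|exact: V_add|].
  rewrite mulrC; have -> : T ^+ b i = 'X^(b i) \Po T by rewrite rmorphXn /= comp_polyX.
  apply: V_comp; rewrite mulrC; elim: (a i) => [|j IH].
    by rewrite expr0 mul1r; apply: V_const.
  by rewrite exprS -mulrA; apply: V_Z.
move=> [cs fE]; pose g j := (cs j \Po T) * Z ^+ j.
have Z0 : Z != 0 by rewrite -size_poly_eq0 sZ.
have sg j : g j != 0 -> size (g j) = (((size (cs j)).-1 * al + q * j) * n).+1.
  rewrite mulf_eq0 negb_or => /andP[cs0 _].
  rewrite /g size_mul ?expf_neq0 //.
  rewrite -[size (_ \Po _)]prednK ?size_poly_gt0 // size_comp_poly sT.
  rewrite -[size (Z ^+ j)]prednK ?size_poly_gt0 ?expf_neq0 // size_exp sZ.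
  by rewrite addSn addnS /=; congr _.+1; rewrite mulnDl mulnA; ring.
rewrite fE -/(\sum_(j < al) g j).
have [i j ial jal gi0 gj0|->|[j [jal gj0 ->]]] := @size_sum_distinct _ al g.
(* Equal sizes give q i = q j modulo [al], hence i = j by coprimality, as both are below [al]. *)
- rewrite !sg // => -[] /eqP; rewrite eqn_pmul2r // => /eqP /(congr1 (modn^~ al)) /eqP.
  rewrite !modnMDl; wlog ij : i j ial jal {gi0 gj0} / (i <= j)%N => [H|].
    by case/orP: (leq_total i j) => ij e; [|apply/esym]; apply: H => //; rewrite eq_sym.
  rewrite eq_sym eqn_mod_dvd ?leq_mul2l ?ij ?orbT // -mulnBr Gauss_dvdr //.
  move=> dv; apply/eqP; rewrite eqn_leq ij /= leqNgt.
  apply/negP => lt; have := dvdn_leq _ dv; rewrite subn_gt0 lt => /(_ isT).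
  by rewrite leqNgt (leq_ltn_trans (leq_subr _ _)).
- by left; rewrite size_poly0.
rewrite sg //; set u := (size (cs j)).-1.
(* The degree is (u al + q j) n with [al] and [q] at least 2, so it is 0 or at least 2n. *)
case: (posnP u) => [->|u0].
  case: (posnP j) => [->|j0]; first by left; rewrite muln0.
  right; rewrite mul0n add0n ltnS leq_pmul2r //; nia.
right; rewrite ltnS leq_pmul2r //; nia.
Qed.

End CuspCurve.

Lemma mmap_dvd (n : nat) (k : nzRingType) (T : comNzRingType) (f : k -> T)
    (h : 'I_n -> T) (i : 'I_n) (g : {mpoly k[n]}) :
  (forall b, b \in msupp g -> b i != 0%N) -> exists c, mmap f h g = h i * c.
Proof.
move=> gi; exists (\sum_(b <- msupp g) f g@_b * mmap1 h (b - U_(i))%MM).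
rewrite mulr_sumr /mmap big_seq [RHS]big_seq; apply: eq_bigr => b /gi bi.
rewrite mulrCA; congr (_ * _); rewrite -[h i](mmap1U h i) -commr_mmap1_M.
  by rewrite addmC submK // lep1mP.
by move=> j x; apply: mulrC.
Qed.

(** * Exponential maps on the hypersurface *)

Section Hypersurface.
Variables (k : fieldType) (p e S m : nat).
Hypotheses (kp : p \in [pchar k]) (S1 : (1 < S)%N).
Local Notation Q := (p ^ e)%N.
Local Notation E := {mpoly k[3]}.
Local Notation M := {mpoly k[4]}.

Variables (P : idomainType) (cP : {rmorphism k -> P}) (iota : {rmorphism P -> E}).
Variable h : 'I_4 -> P.
Hypothesis iotaC : forall c, iota (cP c) = c%:MP.
Hypothesis iota_h : forall i, iota (h i) = coord_root k Q S m i.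
Hypothesis h_rel : h 2 ^+ Q = - (h 0 ^+ m * h 1 + h 3 ^+ S + h 3).
Hypothesis h_gen : forall a, exists g, a = mmap cP h g.
Local Notation ev := (mmap cP h).

Let p_prime : prime p. Proof. exact: pcharf_prime kp. Qed.
Let Q0 : (0 < Q)%N. Proof. by rewrite expn_gt0 prime_gt0. Qed.

Lemma pchar_pow_nat i : [pchar {mpoly k[3]}].-nat (p ^ i)%N.
Proof.
rewrite pnatX; apply/orP; left; rewrite pnatE // inE p_prime /=.
by rewrite -mpolyC_nat pcharf0 // mpolyC0.
Qed.

Lemma coord_root_relation : coord_root k Q S m 0 ^+ m * coord_root k Q S m 1 +
  coord_root k Q S m 2 ^+ Q + coord_root k Q S m 3 + coord_root k Q S m 3 ^+ S = 0.
Proof.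
rewrite /coord_root /pt4 /= exprNn_pchar ?pchar_pow_nat //.
rewrite !exprDn_pchar ?pchar_pow_nat // exprMn -!exprM (mulnC S) (mulnC m); ring.
Qed.

Lemma mmap1_h (b : 'X_{1..4}) :
  mmap1 h b = h 0 ^+ b 0 * h 1 ^+ b 1 * h 2 ^+ b 2 * h 3 ^+ b 3.
Proof. by rewrite /mmap1 big_ord4. Qed.

Let N (a : P) := exists g, reduced Q g /\ a = ev g.

Let N_add a b : N a -> N b -> N (a + b).
Proof.
move=> [g [rg ->]] [g' [rg' ->]]; exists (g + g'); split; last by rewrite raddfD.
by move=> c /msuppD_le; rewrite mem_cat => /orP[/rg|/rg'].
Qed.

Let N_scale c a : N a -> N (cP c * a).
Proof.
move=> [g [rg ->]]; exists (c *: g); split; last by rewrite mmapZ.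
by move=> b /msuppZ_le /rg.
Qed.

Let N_opp a : N a -> N (- a).
Proof. by move=> /(N_scale (-1)); rewrite rmorphN1 mulN1r. Qed.

(** Strong induction on the exponent of z: applying the relation once lowers it by [Q]. *)
Let N_mon j i0 i1 i3 : N (h 0 ^+ i0 * h 1 ^+ i1 * h 2 ^+ j * h 3 ^+ i3).
Proof.
elim/ltn_ind: j i0 i1 i3 => j IH i0 i1 i3.
have [jQ|Qj] := ltnP j Q.
  exists 'X_[[multinom pt4 i0 i1 j i3 i | i < 4]]; split.
    by move=> b; rewrite msuppX inE => /eqP ->; rewrite mnmE.
  by rewrite mmapX mmap1_h !mnmE.
have lt : (j - Q < j)%N by rewrite ltn_subrL Q0 (leq_trans Q0).
have -> : h 0 ^+ i0 * h 1 ^+ i1 * h 2 ^+ j * h 3 ^+ i3 =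
  - (h 0 ^+ (i0 + m) * h 1 ^+ i1.+1 * h 2 ^+ (j - Q) * h 3 ^+ i3 +
     h 0 ^+ i0 * h 1 ^+ i1 * h 2 ^+ (j - Q) * h 3 ^+ (i3 + S) +
     h 0 ^+ i0 * h 1 ^+ i1 * h 2 ^+ (j - Q) * h 3 ^+ i3.+1).
  rewrite -[in LHS](subnK Qj) exprD h_rel !exprD !exprS.
  by move: (h 2 ^+ (j - Q)) => c; ring.
by apply: N_opp; do 2?apply: N_add; apply: IH.
Qed.

Lemma reduced_form a : exists g, reduced Q g /\ a = ev g.
Proof.
have [g ->] := h_gen a; rewrite -/(N _) /mmap.
elim/big_ind: _ => [||b _]; [|exact: N_add|by apply: N_scale; rewrite mmap1_h].
by exists 0; split; rewrite ?raddf0 // => b; rewrite msupp0.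
Qed.

Section Weights.
Variable om : rat.
Local Notation wE := (root_wt Q S m om).
Local Notation wM := (coord_wt Q S m om).
Local Notation Eb := (bounded (wpart wE (k := k))).
Local Notation Mb := (bounded (wpart wM (k := k))).

Lemma iota_ev g : iota (ev g) = mmap (@mpolyC 3 k) (coord_root k Q S m) g.
Proof. by rewrite rmorph_mmap; apply: eq_mmap. Qed.

Lemma iota_ev_part v g : Mb v g -> Eb v (iota (ev g)) /\
  wpart wE v (iota (ev g)) = mmap (@mpolyC 3 k) (coord_top k Q S m) (wpart wM v g).
Proof. by move=> bg; rewrite iota_ev; apply: coord_mmap_part. Qed.

Lemma ev_lead_neq0 v g : reduced Q g -> wpart wM v g != 0 -> Mb v g ->
  wpart wE v (iota (ev g)) != 0.
Proof.
move=> rg g0 /iota_ev_part[_ ->].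
by apply: reduced_coord_top_neq0 => //; apply: reduced_wpart.
Qed.

(** The leading form of a reduced polynomial survives under [iota], so its monomials cannot exceed
    the weight of the element it represents. *)
Lemma reduced_bounded v g : reduced Q g -> Eb v (iota (ev g)) -> Mb v g.
Proof.
move=> rg bv; have [->|g0] := eqVneq g 0; first exact: (@bounded0 _ (wgrading wM k)).
have [u [bu [a ag au]]] := wdeg_exists wM g0.
apply: (@bounded_le _ (wgrading wM k) u) => //; rewrite leNgt; apply/negP => /bv.
by apply/eqP; apply: ev_lead_neq0 => //; apply: wpart_neq0 au.
Qed.

(** * Symbols: the exponential map on leading forms *)

Section Exponential.
Variables (Phi : {rmorphism P -> {poly P}}) (w : rat).
Hypothesis PhiC : forall c, Phi (cP c) = (cP c)%:P.
Definition extend (a : P) : {poly E} := map_poly iota (Phi a).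
Local Notation lead := (ppart (wgrading wE k) w).
Local Notation Ub := (bounded lead).
Hypothesis slope : forall i, Ub (wM i) (extend (h i)).

(* The exponential map induced by [Phi] on leading forms; [v] must bound the
   weight of [a], and the result is [0] when it bounds it strictly. *)
Definition symbol (v : rat) (a : P) : {poly E} := lead v (extend a).

Let cU : {rmorphism k -> {poly E}} := polyC \o @mpolyC 3 k.

Lemma coef_symbol v a i :
  (symbol v a)`_i = wpart wE (v + w *+ i) (iota (Phi a)`_i).
Proof. by rewrite coef_ppart coef_map. Qed.

(** [mmap_part] applied to the graded ring of polynomials in U; [slope] provides the bounds on the
    images of the generators. *)
Lemma extend_ev_part v g : Mb v g -> Ub v (extend (ev g)) /\
  symbol v (ev g) = mmap cU (fun i => symbol (wM i) (h i)) (wpart wM v g).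
Proof.
have cUb c : Ub 0 (cU c).
  apply/pboundedP => -[|i]; rewrite coefC /=; last exact: (@bounded0 _ (wgrading wE k)).
  by rewrite mulr0n addr0; case: (whomogC wE c).
have cUp c : lead 0 (cU c) = cU c.
  apply/polyP => -[|i]; rewrite coef_ppart coefC /=; last exact: (part0 (wgrading wE k)).
  by rewrite mulr0n addr0; case: (whomogC wE c).
move=> bg; rewrite /symbol.
have -> : extend (ev g) = mmap cU (extend \o h) g.
  rewrite /extend (rmorph_mmap Phi) (rmorph_mmap (map_poly iota)).
  by apply: eq_mmap => // c /=; rewrite PhiC map_polyC /= iotaC.
exact: (mmap_part (pr := pgrading (wgrading wE k) w) cUb cUp slope bg).
Qed.

(** Every symbol is a polynomial in the symbols of the generators, involving only monomials of
    weight [v]. Divisibility and degree arguments on symbols rest on this. *)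
Lemma symbol_rep v a : Eb v (iota a) -> exists g, [/\ reduced Q g, Mb v g,
  a = ev g,
  symbol v a = mmap cU (fun i => symbol (wM i) (h i)) (wpart wM v g) &
  wpart wE v (iota a) = mmap (@mpolyC 3 k) (coord_top k Q S m) (wpart wM v g)].
Proof.
have [g [rg ->]] := reduced_form a => bv; exists g.
have bg := reduced_bounded rg bv.
by split=> //; [case: (extend_ev_part bg)|case: (iota_ev_part bg)].
Qed.

Lemma extend_bounded v a : Eb v (iota a) -> Ub v (extend a).
Proof. by move=> /symbol_rep[g [_ bg -> _ _]]; case: (extend_ev_part bg). Qed.

Lemma symbolM u v a b : Eb u (iota a) -> Eb v (iota b) ->
  symbol (u + v) (a * b) = symbol u a * symbol v b.
Proof.
move=> /extend_bounded ba /extend_bounded bb.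
rewrite /symbol /extend !rmorphM.
exact: (part_mul (pr := pgrading (wgrading wE k) w) ba bb).
Qed.

Lemma symbolD v a b : symbol v (a + b) = symbol v a + symbol v b.
Proof.
by rewrite /symbol /extend !rmorphD; apply: (partD (pgrading (wgrading wE k) w)).
Qed.

Lemma symbolN v a : symbol v (- a) = - symbol v a.
Proof.
by rewrite /symbol /extend !rmorphN; apply: (partN (pgrading (wgrading wE k) w)).
Qed.

Hypothesis Phi0 : forall a, (Phi a)`_0 = a.
Hypothesis Phi_iter : forall a i l, (Phi (Phi a)`_l)`_i = (Phi a)`_(i + l) *+ 'C(i + l, i).

Let EpQ : p \in [pchar E].
Proof. by have := pchar_pow_nat 1; rewrite expn1 pnatE. Qed.

(** By [symbol_lt], a nonzero symbol forbids any bound below [v], so [v] is the weight of [a]. *)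
Definition exact_wt v a := Eb v (iota a) /\ symbol v a != 0.
Local Notation udeg v a := (size (symbol v a)).-1.

Lemma coef_bounded v a i : Eb v (iota a) -> Eb (v + w *+ i) (iota (Phi a)`_i).
Proof.
by move=> /extend_bounded /pboundedP /(_ i); rewrite coef_map.
Qed.

Lemma symbol_coef v a l i :
  (symbol (v + w *+ l) (Phi a)`_l)`_i = (symbol v a)`_(i + l) *+ 'C(i + l, i).
Proof.
rewrite !coef_symbol Phi_iter raddfMn -addrA -mulrnDr addnC /=.
by apply/mpolyP => b; rewrite mcoeffMn !mcoeff_wpart mcoeffMn mulrnAC.
Qed.

(** By [symbol_coef], a coefficient of positive index in the symbol of the leading coefficient is a
    multiple of one beyond the degree of the symbol of [a]. *)
Lemma lead_coef_fixed v a (l := udeg v a) : exact_wt v a ->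
  exact_wt (v + w *+ l) (Phi a)`_l /\ udeg (v + w *+ l) (Phi a)`_l = 0%N.
Proof.
move=> [ba a0].
have c0 : (symbol (v + w *+ l) (Phi a)`_l)`_0 != 0.
  by rewrite symbol_coef add0n bin0 mulr1n -/(lead_coef _) lead_coef_eq0.
split; first split; first exact: coef_bounded.
  by apply: contraNneq c0 => ->; rewrite coef0.
rewrite (size1_polyC (p := symbol _ _)) ?size_polyC; first by case: (_ != 0).
apply/leq_sizeP => j j0; rewrite symbol_coef nth_default ?mul0rn //.
by apply: leq_trans (leqSpred _) _; rewrite -add1n leq_add2r.
Qed.

(* With [l = p ^ i * l'], the coefficient of [U ^ (l - p ^ i)] has degree [p ^ i],
   since ['C(l, p ^ i)] is prime to [p]. *)
Lemma pow_udeg_attained v a : exact_wt v a -> (0 < udeg v a)%N ->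
  exists v' a', exact_wt v' a' /\ udeg v' a' = (p ^ logn p (udeg v a))%N.
Proof.
move=> [ba a0] l0; set l := udeg v a in l0 *; set i := (p ^ logn p l)%N.
have il : (i <= l)%N by apply: dvdn_leq (pfactor_dvdnn _ _).
have lE : l = (i * (l`_p^')%N)%N by rewrite /i -p_part partnC.
have szl : size (symbol v a) = l.+1 by rewrite prednK // size_poly_gt0.
exists (v + w *+ (l - i)), (Phi a)`_(l - i).
have c0 : (symbol (v + w *+ (l - i)) (Phi a)`_(l - i))`_i != 0.
  rewrite symbol_coef subnKC // -mulr_natr mulf_neq0 //.
    by rewrite -/(lead_coef _) lead_coef_eq0.
  rewrite {1}lE; apply: (pchar_bin_pow_neq0 _ EpQ).
  by rewrite -p'natE // part_pnat.
split; first by split; [exact: coef_bounded|apply: contraNneq c0 => ->; rewrite coef0].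
suff -> : size (symbol (v + w *+ (l - i)) (Phi a)`_(l - i)) = i.+1 by [].
apply/eqP; rewrite eqn_leq andbC.
apply/andP; split; first by rewrite ltnNge; apply: contra c0 => /leq_sizeP ->.
apply/leq_sizeP => j ij; rewrite symbol_coef nth_default ?mul0rn // szl.
by rewrite -(ltn_add2r (l - i)) subnKC in ij.
Qed.

(** Take the least positive degree. By [pow_udeg_attained] its [p]-part is attained as well, so it
    is a power of [p]; the [p]-part of any other positive degree is attained too, hence at least as
    large, hence a multiple. *)
Lemma min_udeg v a : exact_wt v a -> (0 < udeg v a)%N ->
  exists v0 a0 i, [/\ exact_wt v0 a0, udeg v0 a0 = (p ^ i)%N &
    forall v' a', exact_wt v' a' -> (p ^ i %| udeg v' a')%N].
Proof.
move=> xa l0.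
have [v0 [a0 [xa0 d0 dmin]]] : exists v0 a0, [/\ exact_wt v0 a0, (0 < udeg v0 a0)%N &
    forall v' a', exact_wt v' a' -> (0 < udeg v' a')%N ->
      (udeg v0 a0 <= udeg v' a')%N].
  elim/ltn_ind: {a}(udeg v a) {-2}v {-2}a (erefl (udeg v a)) xa l0 => d IH {}v a dE xa d0; subst d.
  have [[v' [a' [xa' d'0 lt]]]|none] := Classical_Prop.classic (exists v' a',
      [/\ exact_wt v' a', (0 < udeg v' a')%N & (udeg v' a' < udeg v a)%N]).
    exact: (IH _ lt v' a').
  exists v, a; split=> // v' a' xa' d'0; rewrite leqNgt.
  by apply/negP => lt; apply: none; exists v', a'.
have [v1 [a1 [xa1 d1]]] := pow_udeg_attained xa0 d0.
have d0E : udeg v0 a0 = (p ^ logn p (udeg v0 a0))%N.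
  apply/eqP; rewrite eqn_leq; apply/andP; split; last exact: dvdn_leq (pfactor_dvdnn _ _).
  by rewrite -d1 dmin // d1 expn_gt0 prime_gt0.
exists v0, a0, (logn p (udeg v0 a0)); split=> // v' a' xa'.
have [->|d'0] := posnP (udeg v' a'); first exact: dvdn0.
have [v2 [a2 [xa2 d2]]] := pow_udeg_attained xa' d'0.
rewrite pfactor_dvdn // -(leq_exp2l _ _ (prime_gt1 p_prime)) -d0E -d2 dmin //.
by rewrite d2 expn_gt0 prime_gt0.
Qed.

Lemma gen_bounded i : Eb (wM i) (iota (h i)).
Proof. by rewrite iota_h; case: (coord_part k m Q0 S1 om i). Qed.
Arguments gen_bounded : clear implicits.

Lemma symbol1 : symbol 0 1 = 1.
Proof.
apply/polyP => i; rewrite coef_symbol rmorph1 !coef1 add0r.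
case: i => [|i] /=; rewrite ?rmorph0 ?rmorph1; last exact: (part0 (wgrading wE k)).
by rewrite mulr0n -(rmorph1 (@mpolyC 3 k)); case: (whomogC wE (1 : k)).
Qed.

Lemma symbol_exp v a n : Eb v (iota a) ->
  Eb (v *+ n) (iota (a ^+ n)) /\ symbol (v *+ n) (a ^+ n) = symbol v a ^+ n.
Proof.
move=> ba; elim: n => [|n [IHb IHs]].
  rewrite mulr0n !expr0 symbol1 rmorph1; split=> //.
  by rewrite -(rmorph1 (@mpolyC 3 k)); case: (whomogC wE (1 : k)).
rewrite !exprS mulrS symbolM // IHs; split=> //.
by rewrite rmorphM; apply: (boundedM (pr := wgrading wE k)).
Qed.

Lemma symbol_lt u v a : Eb u (iota a) -> u < v -> symbol v a = 0.
Proof. by move=> /extend_bounded ba /ba. Qed.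

Lemma symbol_gen_dvd i v a : Eb v (iota a) ->
  (forall b, weight wM b = v -> b i != 0%N) ->
  exists c, symbol v a = symbol (wM i) (h i) * c.
Proof.
move=> /symbol_rep[g [_ _ _ -> _]] vi.
by apply: (@mmap_dvd _ _ _ cU (fun j => symbol (wM j) (h j)) i) => b /msupp_wpart[_ /vi].
Qed.

(** * No nontrivial symbol map fixes y *)

Section Contradiction.
Variables r q : nat.
Hypotheses (Sqr : S = (p ^ r * q)%N) (r0 : (0 < r)%N) (re : (r < e)%N).
Hypotheses (q1 : (1 < q)%N) (pq : ~~ (p %| q)%N) (m1 : (1 < m)%N).
Hypothesis om_int : om *+ m \is a Num.int.
Hypothesis om_dvd : forall j, om *+ j \is a Num.int -> (m %| j)%N.
Hypothesis Y_fixed : udeg (wM 1) (h 1) = 0%N.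
Hypothesis nontrivial : exists i, (0 < udeg (wM i) (h i))%N.
Local Notation al := (p ^ (e - r))%N.
Local Notation X := (symbol (wM 0) (h 0)).
Local Notation Y := (symbol (wM 1) (h 1)).
Local Notation Z := (symbol (wM 2) (h 2)).
Local Notation T := (symbol (wM 3) (h 3)).

Let p1 : (1 < p)%N. Proof. exact: prime_gt1. Qed.

Let al1 : (1 < al)%N. Proof. by rewrite -(exp1n (e - r)) ltn_exp2r // subn_gt0. Qed.

Lemma gen_exact i : exact_wt (wM i) (h i).
Proof.
split; first exact: gen_bounded.
suff: (symbol (wM i) (h i))`_0 != 0 by apply: contraNneq => ->; rewrite coef0.
rewrite coef_symbol mulr0n addr0 Phi0 iota_h.
have [_ ->] := coord_part k m Q0 S1 om i.
have := reduced_coord_top_neq0 (k := k) (g := 'X_i) S m Q0.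
rewrite mmapX mmap1U; apply.
  by apply/eqP => /(congr1 (mcoeff U_(i))); rewrite mcoeffXU eqxx mcoeff0 => /eqP; rewrite oner_eq0.
move=> b; rewrite msuppX inE => /eqP ->; rewrite mnm1E.
(* A generator is reduced as a monomial because its exponents are at most 1 < [Q]. *)
have Q1 : (1 < Q)%N by rewrite -(exp1n e) ltn_exp2r // (leq_trans r0) // ltnW.
by case: (_ == _).
Qed.

(** The common weight of z^al and t^q, by [alS] below. *)
Let wG : rat := (q * Q)%:R.
Let G := h 2 ^+ al + h 3 ^+ q.

Let alS : (al * S = q * Q)%N.
Proof. by rewrite Sqr mulnA -expnD subnK ?(ltnW re) // mulnC. Qed.

Let bG : Eb wG (iota G).
Proof.
rewrite rmorphD; apply: (boundedD (pr := wgrading wE k)).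
  have [b _] := symbol_exp al (gen_bounded 2); move: b.
  by rewrite -[wM 2]/(S%:R : rat) -mulrnA mulnC alS.
have [b _] := symbol_exp q (gen_bounded 3); move: b.
by rewrite -[wM 3]/(Q%:R : rat) -mulrnA mulnC.
Qed.

Let sG : symbol wG G = Z ^+ al + T ^+ q.
Proof.
rewrite symbolD; congr (_ + _).
  have [_ <-] := symbol_exp al (gen_bounded 2).
  by rewrite -[wM 2]/(S%:R : rat) -mulrnA mulnC alS.
have [_ <-] := symbol_exp q (gen_bounded 3).
by rewrite -[wM 3]/(Q%:R : rat) -mulrnA mulnC.
Qed.

(** The [p ^ r]-th power of [G] is z^Q + t^S, which the relation turns into -(x^m y + t). *)
Let XYG : X ^+ m * Y = - (symbol wG G) ^+ (p ^ r).
Proof.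
have Pp : [pchar P].-nat (p ^ r)%N.
  rewrite pnatX; apply/orP; left; rewrite pnatE // inE p_prime /=.
  by rewrite -(rmorph_nat cP) pcharf0 // rmorph0.
have GE : G ^+ (p ^ r) = - (h 0 ^+ m * h 1 + h 3).
  rewrite exprDn_pchar // -!exprM -expnD subnK ?(ltnW re) //.
  by rewrite h_rel mulnC -Sqr; ring.
have [_ <-] := symbol_exp (p ^ r) bG.
rewrite GE symbolN opprK symbolD.
have wX : wG *+ (p ^ r) = wM 0 *+ m + wM 1.
  rewrite /wG -mulrnA (_ : (q * Q * p ^ r = Q * S)%N); last first.
    by rewrite Sqr mulnAC mulnC (mulnC q).
  by rewrite -[wM 0]/(- om) -[wM 1]/(om *+ m + (Q * S)%:R) mulNrn addKr.
(* The term t has weight [Q], strictly below [wG *+ (p ^ r)], and drops out. *)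
rewrite (@symbol_lt Q%:R _ (h 3)); last 2 first.
- exact: (gen_bounded 3).
- by rewrite /wG -mulrnA ltr_nat; have := expn_gt0 p r; nia.
have [bx sx] := symbol_exp m (gen_bounded 0).
by rewrite addr0 wX symbolM // ?sx //; apply: gen_bounded.
Qed.

Let G_exact : exact_wt wG G.
Proof.
split=> //; apply: contraTneq isT => G0.
have [[_ X0] [_ Y0]] := (gen_exact 0, gen_exact 1).
have := XYG; rewrite G0 expr0n gtn_eqF ?expn_gt0 ?prime_gt0 // oppr0 => /eqP.
by rewrite mulf_eq0 expf_eq0 (negPf X0) (negPf Y0) andbF.
Qed.

Let udegXG : (udeg (wM 0)%R (h 0%R) * m = udeg wG G * p ^ r)%N.
Proof.
have [[_ X0] [_ Y0]] := (gen_exact 0, gen_exact 1).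
rewrite -!size_exp -[RHS](congr1 predn (size_polyN _)) -XYG size_mul ?expf_neq0 //.
by rewrite -(prednK (_ : 0 < size Y)%N) ?size_poly_gt0 // Y_fixed addn1.
Qed.

(** A monomial without x has integral weight because [om *+ m] is an integer; in a nonintegral
    weight every monomial contains x, so [X] divides the symbol. *)
Lemma nonint_weight v a : exact_wt v a -> v \isn't a Num.int ->
  (udeg (wM 0)%R (h 0%R) <= udeg v a)%N.
Proof.
move=> [ba a0] vint; have [c cE] : exists c, symbol v a = X * c.
  apply: symbol_gen_dvd => // b bv; apply: contra vint => /eqP b0.
  rewrite -bv weight_pt4 b0 mulr0n add0r.
  by do ![exact: om_int | apply: rpred_nat | apply: rpredD | apply: rpredMn].
move: a0; rewrite cE mulf_eq0 negb_or => /andP[X0 c0].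
by rewrite size_mul // -[size c]prednK ?size_poly_gt0 // addnS /= -!subn1 leq_sub2r // leq_addr.
Qed.

Let s_exists : exists v0 s i, [/\ exact_wt v0 s, udeg v0 s = (p ^ i)%N &
    forall v' a', exact_wt v' a' -> (p ^ i %| udeg v' a')%N].
Proof. by have [i di] := nontrivial; apply: min_udeg (gen_exact i) di. Qed.

Let wG_int : wG \is a Num.int. Proof. exact: rpred_nat. Qed.

(** The weight in question is that of the leading coefficient, which has degree 0; were it
    nonintegral, [nonint_weight] would force x to have degree 0. *)
Let fixed_int v a : (0 < udeg (wM 0)%R (h 0%R))%N -> exact_wt v a ->
  v + w *+ udeg v a \is a Num.int.
Proof.
move=> dx xa; have [xb db] := lead_coef_fixed xa.
by apply: contraTT dx => /(nonint_weight xb); rewrite db -leqNgt.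
Qed.

Let int_addr (x y : rat) : y \is a Num.int -> x + y \is a Num.int -> x \is a Num.int.
Proof. by move=> yint xyint; rewrite -(addrK y x) rpredB. Qed.

Let int_addl (x y : rat) : x \is a Num.int -> x + y \is a Num.int -> y \is a Num.int.
Proof. by rewrite addrC; apply: int_addr. Qed.

Let int_opp (x : rat) : - x \is a Num.int -> x \is a Num.int.
Proof. by move=> xint; rewrite -(opprK x) rpredN. Qed.

Let X_nonfixed : ~~ (0 < udeg (wM 0)%R (h 0%R))%N.
Proof.
apply/negP => dx; have [v0 [s [i [xs ds dvd]]]] := s_exists.
have fs := fixed_int dx xs; have fx := fixed_int dx (gen_exact 0).
have fG := fixed_int dx G_exact.
have [[jx jxE] [jG jGE]] := (dvdnP (dvd _ _ (gen_exact 0)), dvdnP (dvd _ _ G_exact)).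
have om_not_int : om \isn't a Num.int.
  by apply/negP => /(om_dvd (j := 1)); rewrite dvdn1 gtn_eqF.
(* If [v0] is integral, so is [w *+ p ^ i], hence [w] times the degree of x, and [fx] makes [om]
   integral. *)
have [v0int|v0int] := boolP (v0 \is a Num.int).
  rewrite ds in fs; move: fx; rewrite jxE mulnC mulrnA => fx.
  case/negP: om_not_int; apply: int_opp; apply: int_addr fx; apply: rpredMn.
  exact: int_addl fs.
(* Otherwise [X] divides the symbol of [s], so the degree of x is at most the least positive
   degree. *)
have dxE : udeg (wM 0)%R (h 0%R) = (p ^ i)%N.
  apply/eqP; rewrite eqn_leq -{1}ds nonint_weight //=.
  by apply: dvdn_leq => //; apply: dvd; apply: gen_exact.
have pi0 : (0 < p ^ i)%N by rewrite expn_gt0 prime_gt0.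
have mE : m = (jG * p ^ r)%N.
  apply/eqP; rewrite -(eqn_pmul2l pi0) -{1}dxE udegXG jGE; apply/eqP; ring.
have jG0 : (0 < jG)%N by rewrite lt0n; apply: contraTneq m1 => jG0; rewrite mE jG0.
(* Modulo integers [om] equals [w *+ p ^ i], and [jG] times the latter is integral by [fG]. Then [m]
   divides [jG], yet [m] is [jG * p ^ r] with [r] positive. *)
have : om *+ jG \is a Num.int.
  move: fx fG; rewrite dxE jGE mulnC mulrnA => fx /(int_addl wG_int) fG.
  have := rpredMn jG fx; rewrite mulrnDl -[wM 0]/(- om) => /(int_addr fG).
  by rewrite mulNrn; apply: int_opp.
move/om_dvd/(dvdn_leq jG0); rewrite {1}mE leqNgt ltn_Pmulr //.
by rewrite -(exp1n r) ltn_exp2r.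
Qed.

Lemma hypersurface_contradiction : False.
Proof.
have X0 : udeg (wM 0)%R (h 0%R) = 0%N by apply/eqP; rewrite -leqn0 leqNgt X_nonfixed.
have pr0 : (0 < p ^ r)%N by rewrite expn_gt0 prime_gt0.
have G0 : udeg wG G = 0%N.
  by apply/eqP; rewrite -(eqn_pmul2r pr0) -udegXG X0.
have [[_ Z0] [_ T0]] := (gen_exact 2, gen_exact 3).
have [_ sG0] := G_exact.
have szG : size (Z ^+ al + T ^+ q) = 1%N.
  by rewrite -sG -[LHS]prednK ?G0 // size_poly_gt0.
have szZ : size (Z ^+ al) = ((udeg (wM 2)%R (h 2%R)) * al).+1.
  by rewrite -[LHS]prednK ?size_exp // size_poly_gt0 expf_neq0.
have szT : size (T ^+ q) = ((udeg (wM 3)%R (h 3%R)) * q).+1.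
  by rewrite -[LHS]prednK ?size_exp // size_poly_gt0 expf_neq0.
(* The sum is constant, so the leading terms cancel: unequal sizes would make the larger one equal
   to 1, leaving size 0 for the other. *)
have zt : (udeg (wM 2)%R (h 2%R) * al = udeg (wM 3)%R (h 3%R) * q)%N.
  case: (ltngtP (size (Z ^+ al)) (size (T ^+ q))) => [lt|lt|].
  - by have := szG; rewrite addrC size_polyDl // => sz1; rewrite sz1 szZ in lt.
  - by have := szG; rewrite size_polyDl // => sz1; rewrite sz1 szT in lt.
  - by rewrite szZ szT => -[].
have cop : coprime al q by rewrite coprimeXl // prime_coprime.
have [n nE] : exists n, udeg (wM 2)%R (h 2%R) = (q * n)%N.
  have /dvdnP[n ->] : (q %| udeg (wM 2)%R (h 2%R))%N.
    by rewrite -(@Gauss_dvdl q _ al) 1?coprime_sym // zt dvdn_mull.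
  by exists n; rewrite mulnC.
have nE' : udeg (wM 3)%R (h 3%R) = (al * n)%N.
  apply/eqP; rewrite -(eqn_pmul2r (ltnW q1)) -zt nE; apply/eqP; ring.
have n0 : (0 < n)%N.
  rewrite lt0n; apply/eqP => n0; have [i] := nontrivial.
  suff -> : udeg (wM i) (h i) = 0%N by [].
  by move: i; apply: forall_ord4; rewrite ?X0 ?Y_fixed ?nE ?nE' ?n0 ?muln0.
have [v0 [s [i [[bs s0] ds dvd]]]] := s_exists.
(* [p ^ i] divides q n, the degree of z, and is prime to [q]. *)
have lein : (p ^ i <= n)%N.
  apply: dvdn_leq => //; rewrite -(@Gauss_dvdr (p ^ i) q n).
    by rewrite -nE; apply: dvd; apply: gen_exact.
  by rewrite coprimeXl // prime_coprime.
pose c0 := (symbol wG G)`_0.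
have ZT : Z ^+ al = c0%:P - T ^+ q.
  apply/eqP; rewrite eq_sym subr_eq -sG; apply/eqP/esym/size1_polyC.
  by rewrite sG szG.
have sZ : size Z = (q * n).+1 by rewrite -nE prednK ?size_poly_gt0.
have sT : size T = (al * n).+1 by rewrite -nE' prednK ?size_poly_gt0.
have [g [_ _ _ sE _]] := symbol_rep bs.
(* [X] and [Y] being constant in U, the symbol of [s] is a polynomial in [Z] and [T]; its degree
   [p ^ i] is positive and at most n, below the bound 2n. *)
have := @cusp_span_size _ Z T c0 al q n al1 q1 n0 cop ZT sZ sT _
  (msupp (wpart wM v0 g))
  (fun b => ((wpart wM v0 g)@_b)%:MP * X`_0 ^+ b 0 * Y`_0 ^+ b 1)
  (fun b => b 2) (fun b => b 3) (symbol v0 s).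
have -> : size (symbol v0 s) = (p ^ i).+1 by rewrite -ds prednK // size_poly_gt0.
have i0 : (0 < p ^ i)%N by rewrite expn_gt0 prime_gt0.
case=> [||]; [|by rewrite ltnS leqNgt i0|]; last first.
  by rewrite ltnS => /leq_trans /(_ lein); rewrite leqNgt ltn_Pmull.
rewrite sE; apply: eq_bigr => b _; rewrite /mmap1 big_ord4.
have XC : X = (X`_0)%:P by apply: size1_polyC; rewrite -subn_eq0 subn1 X0.
have YC : Y = (Y`_0)%:P by apply: size1_polyC; rewrite -subn_eq0 subn1 Y_fixed.
by rewrite {1}XC {1}YC !rmorphM !rmorphXn /= !mulrA.
Qed.
End Contradiction.
End Exponential.
End Weights.
End Hypersurface.

(** [w] is the maximum of (d - v) / l over the entries (v, l, a) with [a] nonzero of weight d; an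
    entry attaining it gives the nonzero part. *)
Lemma slope_exists (n : nat) (wt : 'I_n -> rat) (k : comNzRingType)
    (s : seq (rat * nat * {mpoly k[n]})) :
  (forall x, x \in s -> (0 < x.1.2)%N) -> (exists2 x, x \in s & x.2 != 0) ->
  exists w,
    (forall x, x \in s -> bounded (wpart wt (k := k)) (x.1.1 + w *+ x.1.2) x.2) /\
    exists2 x, x \in s & wpart wt (x.1.1 + w *+ x.1.2) x.2 != 0.
Proof.
elim: s => [_ [x]|[[v l] a] s IH pos ex]; first by rewrite in_nil.
have l0 : (0 < l)%N := pos (v, l, a) (mem_head _ _).
have lr : 0 < l%:R :> rat by rewrite ltr0n.
have pos_s x : x \in s -> (0 < x.1.2)%N by move=> xs; apply: pos; rewrite inE xs orbT.
have [a0|a0] := eqVneq a 0.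
  have [|w [bs [y ys wy]]] := IH pos_s.
    case: ex => x; rewrite inE => /orP[/eqP-> /=|xs x0]; last by exists x.
    by rewrite a0 eqxx.
  exists w; split; last by exists y => //; rewrite inE ys orbT.
  move=> x; rewrite inE => /orP[/eqP->|/bs//] /=.
  by rewrite a0; apply: (bounded0 (wgrading wt k)).
have [d [bd [b ba bw]]] := wdeg_exists wt a0.
pose w1 := (d - v) / l%:R.
have w1E : v + w1 *+ l = d.
  by rewrite -mulr_natr mulfVK ?gt_eqF // addrC subrK.
have top : wpart wt (v + w1 *+ l) a != 0 by rewrite w1E; apply: wpart_neq0 bw.
have new w : (forall x, x \in s -> bounded (wpart wt (k := k)) (x.1.1 + w *+ x.1.2) x.2) ->
    w <= w1 -> exists w',
    (forall x, x \in (v, l, a) :: s ->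
       bounded (wpart wt (k := k)) (x.1.1 + w' *+ x.1.2) x.2) /\
    exists2 x, x \in (v, l, a) :: s & wpart wt (x.1.1 + w' *+ x.1.2) x.2 != 0.
  move=> bs ww1; exists w1; split; last by exists (v, l, a); rewrite ?mem_head.
  move=> x; rewrite inE => /orP[/eqP->/=|xs]; first by rewrite w1E.
  apply: (bounded_le (pr := wgrading wt k)) (bs x xs).
  by rewrite lerD2l lerMn2r ww1 orbT.
have [s0|/hasPn s0] := boolP (has (fun x => x.2 != 0) s); last first.
  apply: (new w1) => // x /s0; rewrite negbK => /eqP ->.
  exact: (bounded0 (wgrading wt k)).
have [|w [bs [y ys wy]]] := IH pos_s; first by case/hasP: s0 => x xs x0; exists x.
have [/new|/ltW w1w] := leP w w1; first exact.
exists w; split; last by exists y => //; rewrite inE ys orbT.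
move=> x; rewrite inE => /orP[/eqP->/=|/bs//].
apply: (bounded_le (pr := wgrading wt k)) bd.
by rewrite -w1E lerD2l lerMn2r w1w orbT.
Qed.

(** * Elements fixed by an exponential map *)

Section NoExponentialMap.
Variables (k : fieldType) (p e S m : nat).
Hypotheses (kp : p \in [pchar k]) (S1 : (1 < S)%N).
Local Notation Q := (p ^ e)%N.
Local Notation E := {mpoly k[3]}.
Local Notation M := {mpoly k[4]}.
Variables (P : idomainType) (cP : {rmorphism k -> P}) (iota : {rmorphism P -> E}).
Variable h : 'I_4 -> P.
Hypothesis iotaC : forall c, iota (cP c) = c%:MP.
Hypothesis iota_h : forall i, iota (h i) = coord_root k Q S m i.
Hypothesis h_rel : h 2 ^+ Q = - (h 0 ^+ m * h 1 + h 3 ^+ S + h 3).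
Hypothesis h_gen : forall a, exists g, a = mmap cP h g.
Local Notation ev := (mmap cP h).
Local Notation evK := (mmap cP (pt3 (h 0) (h 2) (h 3))).

Lemma iota_inj : injective iota.
Proof.
apply: raddf_inj => a; have [g [rg ->]] := reduced_form kp h_rel h_gen a => a0.
have [->|g0] := eqVneq g 0; first by rewrite raddf0.
(* Any [om] would serve here; 0 is chosen. *)
have [v [bv [b bg bv']]] := wdeg_exists (coord_wt Q S m 0) g0.
have := ev_lead_neq0 kp S1 iotaC iota_h rg (wpart_neq0 bg bv') bv.
rewrite a0 => /eqP[]; exact: (part0 (wgrading _ k)).
Qed.

(** Every y can be paired with x^m, and x^m y is a polynomial in z and t by the relation. *)
Lemma nonneg_weight_without_Y (g : M) :
  (forall b, b \in msupp g -> (m * b 1%R <= b 0%R)%N) -> exists g', ev g = evK g'.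
Proof.
move=> hg; pose K a := exists g', a = evK g'.
have KD a b : K a -> K b -> K (a + b).
  by move=> [g1 ->] [g2 ->]; exists (g1 + g2); rewrite rmorphD.
have KM a b : K a -> K b -> K (a * b).
  by move=> [g1 ->] [g2 ->]; exists (g1 * g2); rewrite rmorphM.
have KC c : K (cP c) by exists c%:MP; rewrite mmapC.
have KX a n : K a -> K (a ^+ n).
  by move=> [g1 ->]; exists (g1 ^+ n); rewrite rmorphXn.
have K0 : K (h 0) by exists 'X_0; rewrite mmapX mmap1U.
have K2 : K (h 2) by exists 'X_1; rewrite mmapX mmap1U.
have K3 : K (h 3) by exists 'X_2; rewrite mmapX mmap1U.
have KY : K (h 0 ^+ m * h 1).
  have -> : h 0 ^+ m * h 1 = cP (-1) * (h 2 ^+ Q + h 3 ^+ S + h 3).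
    by rewrite h_rel rmorphN1; ring.
  exact: KM (KC _) (KD _ _ (KD _ _ (KX _ _ K2) (KX _ _ K3)) K3).
rewrite -/(K _) /mmap big_seq; elim/big_ind: _ => [||b /hg bg]; [|exact: KD|].
  by exists 0; rewrite rmorph0.
have -> : mmap1 h b =
    h 0 ^+ (b 0%R - m * b 1%R)%N * (h 0 ^+ m * h 1) ^+ b 1 * h 2 ^+ b 2 * h 3 ^+ b 3.
  by rewrite mmap1_h exprMn -exprM mulrA -exprD subnK.
exact: KM (KC _) (KM _ _ (KM _ _ (KM _ _ (KX _ _ K0) (KX _ _ KY)) (KX _ _ K2)) (KX _ _ K3)).
Qed.

Variable Phi : {rmorphism P -> {poly P}}.
Hypothesis PhiC : forall c, Phi (cP c) = (cP c)%:P.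
Hypothesis Phi0 : forall a, (Phi a)`_0 = a.
Hypothesis Phi_iter : forall a i l, (Phi (Phi a)`_l)`_i = (Phi a)`_(i + l) *+ 'C(i + l, i).

Lemma gen_not_fixed a : Phi a != a%:P -> exists i l, (0 < l)%N /\ (Phi (h i))`_l != 0.
Proof.
move=> fa; apply: Classical_Prop.NNPP => none.
have fixed i : Phi (h i) = (h i)%:P.
  apply/polyP => -[|l]; rewrite coefC /= ?Phi0 //.
  by apply/eqP/negPn/negP => l0; apply: none; exists i, l.+1.
case/eqP: fa; have [g ->] := h_gen a.
by rewrite rmorph_mmap (rmorph_mmap polyC); apply: eq_mmap.
Qed.

Theorem fixed_without_Y (r q : nat) (u a : P) : S = (p ^ r * q)%N -> (0 < r)%N ->
  (r < e)%N -> (1 < q)%N -> ~~ (p %| q)%N -> (1 < m)%N ->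
  Phi a != a%:P -> Phi u = u%:P -> exists g', u = evK g'.
Proof.
move=> Sqr r0 re q1 pq m1 /gen_not_fixed[i0 [l0 [l0_gt0 c0]]] fu.
have p_pr := pcharf_prime kp.
have Q0 : (0 < Q)%N by rewrite expn_gt0 prime_gt0.
have [g [rg uE]] := reduced_form kp h_rel h_gen u.
apply: Classical_Prop.NNPP => notK.
have [b0 b0g b0neg] : exists2 b, b \in msupp g & (b 0%R < m * b 1%R)%N.
  apply: Classical_Prop.NNPP => none; apply: notK; rewrite uE.
  apply: nonneg_weight_without_Y => b bg; rewrite leqNgt; apply/negP => lt.
  by apply: none; exists b.
(* [B b] is the share of z and t in the weight of the monomial [b]. *)
pose B (b : 'X_{1..4}) := (S * b 2%R + Q * b 3%R)%N.
(* The sum exceeds no [om] and bounds each [B b]; the summand 1/m makes [om] have exact denominator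
   [m]. *)
pose om : rat := (\sum_(b <- msupp g) B b)%:R + m%:R^-1.
have mr : (m%:R : rat) != 0 by rewrite pnatr_eq0 -lt0n ltnW.
have om_pos : 0 < om by rewrite ltr_wpDl ?ler0n // invr_gt0 ltr0n ltnW.
have om_int : om *+ m \is a Num.int.
  rewrite mulrnDl; apply: rpredD; first exact/rpredMn/rpred_nat.
  by rewrite -[m%:R^-1 *+ m]mulr_natr mulVf // rpred1.
have om_dvd j : om *+ j \is a Num.int -> (m %| j)%N.
  rewrite mulrnDl rpredDl; last exact/rpredMn/rpred_nat.
  move=> /intrP[z zE]; apply/dvdnP; exists `|z|%N.
  have : (j%:Z)%:~R = (z * m%:Z)%:~R :> rat.
    by rewrite rmorphM /= -zE mulrnAl mulVf.
  by move/intr_inj => jE; apply/eqP; rewrite -eqz_nat jE PoszM; lia.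
pose wE := root_wt Q S m om; pose wM := coord_wt Q S m om.
pose F i := extend iota Phi (h i).
(* The coefficients of the positive powers of U in the images of the generators; the range passes
   every degree. *)
pose s := [seq (wM i, l, (F i)`_l) | i <- enum 'I_4,
    l <- seq.iota 1 (\max_i size (F i))].
have [w [bs [x xs xtop]]] : exists w,
    (forall x, x \in s -> bounded (wpart wE (k := k)) (x.1.1 + w *+ x.1.2) x.2) /\
    exists2 x, x \in s & wpart wE (x.1.1 + w *+ x.1.2) x.2 != 0.
  apply: slope_exists => [x /allpairsP[[i l] [_ lt ->]]|].
    by move: lt; rewrite mem_iota => /andP[].
  have F0 : (F i0)`_l0 != 0.
    by rewrite coef_map; apply: contraNneq c0 => F0; apply/eqP/iota_inj; rewrite rmorph0.
  exists (wM i0, l0, (F i0)`_l0) => //; apply/allpairsP; exists (i0, l0).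
  split=> //; first by rewrite mem_enum.
  rewrite mem_iota l0_gt0 add1n ltnS (leq_trans _ (leq_bigmax i0)) // leqNgt.
  by apply: contraNN F0 => lt; rewrite nth_default // ltnW.
have slope i : bounded (ppart (wgrading wE k) w) (wM i) (F i).
  apply/pboundedP => -[|l].
    rewrite mulr0n addr0 coef_map Phi0; exact: (gen_bounded kp S1 iota_h).
  have [le|lt] := leqP (size (F i)) l.+1.
    by rewrite nth_default //; apply: (bounded0 (wgrading wE k)).
  apply: (bs (wM i, l.+1, (F i)`_l.+1)); apply/allpairsP; exists (i, l.+1).
  split=> //; first by rewrite mem_enum.
  by rewrite mem_iota add1n ltnS (leq_trans (ltnW lt) (leq_bigmax i)).
apply: (hypersurface_contradiction kp S1 iotaC iota_h h_rel h_gen PhiC slope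
  Phi0 Phi_iter Sqr r0 re q1 pq m1 om_int om_dvd); last first.
  case/allpairsP: xs => [[i l] [_ lt xE]]; exists i; rewrite {}xE /= in xtop.
  move: lt; rewrite mem_iota => /andP[lgt _]; rewrite -subn1 subn_gt0.
  rewrite ltnNge; apply: contra xtop => sz.
  have e0 := coef_ppart (wgrading wE k) w (wM i) (F i) l; rewrite /= in e0.
  by rewrite -e0 nth_default // (leq_trans sz).
have [v [bv [b1 b1g b1v]]] : exists v, bounded (wpart wM (k := k)) v g /\
    exists2 b, b \in msupp g & weight wM b = v.
  by apply: wdeg_exists; apply: contraTneq b0g => ->; rewrite msupp0.
(* A monomial without y has weight at most its [B b], less than [om], whereas [b0] has weight at
   least [om] because m b0(1) > b0(0). *)
have top b : b \in msupp (wpart wM v g) -> b 1 != 0%N.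
  move=> /msupp_wpart[bg bw]; apply/eqP => by0.
  have := (wboundedP wM v g).1 bv b0 b0g; rewrite -bw !weight_pt4 by0 mulr0n addr0.
  apply/negP; rewrite -ltNge.
  apply: (@lt_le_trans _ _ om).
    have lesum : ((B b)%:R : rat) <= (\sum_(b <- msupp g) B b)%:R.
      by rewrite ler_nat (big_rem b) //= leq_addr.
    rewrite -addrA -!mulrnA -natrD -/(B b) mulNrn.
    apply: (@le_lt_trans _ _ (B b)%:R); first by rewrite gerDr oppr_le0 mulrn_wge0 ?ltW.
    by rewrite (le_lt_trans lesum) // ltrDl invr_gt0 ltr0n ltnW.
  have [d dE] : exists d, (m * b0 1%R = b0 0%R + d.+1)%N.
    by exists (m * b0 1%R - b0 0%R).-1; rewrite prednK ?subn_gt0 // subnKC // ltnW.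
  rewrite mulrnDl -[om *+ m *+ _]mulrnA dE mulrnDr mulNrn mulrS.
  move: om_pos; clear; move: om => x x0; rewrite -!addrA addKr lerDl.
  by rewrite !addr_ge0 // ?mulrn_wge0 // ltW.
(* Since [u] is fixed, its symbol has degree 0; being a nonzero multiple of the symbol of y, it
   forces the latter to have degree 0. *)
have [c cE] : exists c, symbol p e S m iota om Phi w v u =
    symbol p e S m iota om Phi w (wM 1) (h 1) * c.
  rewrite uE; have [_ ->] := extend_ev_part iotaC PhiC slope bv.
  exact: (@mmap_dvd _ _ _ (polyC \o @mpolyC 3 k) (fun j => symbol _ _ _ _ _ _ _ _ _ (h j)) 1).
have su0 : symbol p e S m iota om Phi w v u != 0.
  have := ev_lead_neq0 kp S1 iotaC iota_h rg (wpart_neq0 b1g b1v) bv.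
  apply: contraNneq => su0; have := coef_symbol p e S m iota om Phi w v u 0.
  by rewrite su0 coef0 mulr0n addr0 Phi0 uE => <-.
have : (size (symbol p e S m iota om Phi w v u) <= 1)%N.
  apply/leq_sizeP => j j1; rewrite coef_symbol fu coefC gtn_eqF // rmorph0.
  exact: (part0 (wgrading wE k)).
move: su0; rewrite cE mulf_eq0 negb_or => /andP[Y0 c0'].
rewrite size_mul // -(prednK (_ : 0 < size c)%N) ?size_poly_gt0 // addnS /= => le1.
by apply/eqP; rewrite -leqn0 -ltnS prednK ?size_poly_gt0 // (leq_trans _ le1) ?leq_addr.
Qed.
End NoExponentialMap.

(** * From the quotient ring to generators of a polynomial ring *)

Lemma factor_morphism (R S T : comNzRingType) (f : {rmorphism R -> S})
    (g : {rmorphism R -> T}) :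
  (forall s, exists r, s = f r) -> (forall r, f r = 0 -> g r = 0) ->
  exists i : {rmorphism S -> T}, forall r, i (f r) = g r.
Proof.
move=> f_surj fg; have ex s : exists r, f r == s.
  by have [r ->] := f_surj s; exists r.
pose i s := g (xchoose (ex s)).
have iE r : i (f r) = g r.
  apply/eqP; rewrite -subr_eq0 -rmorphB; apply/eqP/fg.
  by rewrite rmorphB (eqP (xchooseP (ex (f r)))) subrr.
have iB : zmod_morphism i.
  move=> a b; have [r ->] := f_surj a; have [s ->] := f_surj b.
  by rewrite -rmorphB !iE rmorphB.
have iM : monoid_morphism i.
  split=> [|a b]; first by rewrite -(rmorph1 f) iE rmorph1.
  have [r ->] := f_surj a; have [s ->] := f_surj b.
  by rewrite -rmorphM !iE rmorphM.
pose iBm := GRing.isZmodMorphism.Build S T i iB.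
pose iMm := GRing.isMonoidMorphism.Build S T i iM.
pose im : {rmorphism S -> T} := HB.pack i iBm iMm.
by exists im.
Qed.

Lemma generators_not_polynomial_ring (k : fieldType) (p e S m r q : nat)
    (iota : {rmorphism {mpoly k[3]} -> {mpoly k[3]}}) (h : 'I_4 -> {mpoly k[3]}) :
  p \in [pchar k] -> (1 < m)%N -> S = (p ^ r * q)%N -> (0 < r)%N -> (r < e)%N ->
  (1 < q)%N -> ~~ (p %| q)%N -> (forall c, iota c%:MP = c%:MP) ->
  (forall i, iota (h i) = coord_root k (p ^ e) S m i) ->
  h 2 ^+ (p ^ e) = - (h 0 ^+ m * h 1 + h 3 ^+ S + h 3) ->
  ~ (forall a, exists b, a = mmap (@mpolyC 3 k) h b).
Proof.
move=> kp m1 SE r0 re q1 pq iotaC iota_h h_rel h_gen.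
have p0 := prime_gt0 (pcharf_prime kp).
have S1 : (1 < S)%N.
  by rewrite SE (leq_trans q1) // leq_pmull // expn_gt0 p0.
pose K a := exists b, a = mmap (@mpolyC 3 k) (pt3 (h 0) (h 2) (h 3)) b.
have KX (i : 'I_3) : K 'X_i.
  (* An index different from [i]: the translation along ['X_j] is nontrivial and fixes ['X_i]. *)
  pose j : 'I_3 := if i == 0 then 1 else 0.
  have ij : i == j = false by rewrite /j; case: (i =P 0) => [->|/eqP/negPf].
  have [tau [tauC tauX]] := translation_exists k j.
  apply: (fixed_without_Y kp S1 iotaC iota_h h_rel h_gen tauC
    (translation_coef0 tauC tauX) (translation_iter tauC tauX) SE r0 re q1 pq m1
    (a := 'X_j)).
    rewrite tauX eqxx -subr_eq0 addrC addKr.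
    by apply/eqP/polyP => /(_ 1%N) /eqP; rewrite coefX coef0 oner_eq0.
  by rewrite tauX ij addr0.
have Kall a : K a.
  rewrite [a]mpolyE; elim/big_ind: _ => [|_ _ [b ->] [c ->]|c _].
  - by exists 0; rewrite rmorph0.
  - by exists (b + c); rewrite rmorphD.
  rewrite -mul_mpolyC mpolyXE_id.
  suff [b ->] : K (\prod_i 'X_i ^+ c i).
    by exists ((a@_c)%:MP * b); rewrite rmorphM /= mmapC.
  elim/big_ind: _ => [|_ _ [b ->] [d ->]|i _].
  - by exists 1; rewrite rmorph1.
  - by exists (b * d); rewrite rmorphM.
  by have [b ->] := KX i; exists (b ^+ c i); rewrite rmorphXn.
have [b hE] := Kall (h 1).
(* These maps send ['X_0] to 0 and ['X_1] to [c]. Once ['X_0] is 0, the images of x, z and t do not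
   involve ['X_1], whereas y maps to a power of it; so the choices ['X_1] and 0 of [c] must disagree
   on y, yet agree if y lies in k[x, z, t]. *)
have th_ex (c : {mpoly k[3]}) : exists th : {rmorphism {mpoly k[3]} -> {mpoly k[3]}},
    (forall a, th a%:MP = a%:MP) /\ (forall i, th 'X_i = pt3 0 c 'X_2 i).
  by exists (mmap (@mpolyC 3 k) (pt3 0 c 'X_2)); split=> i /=; rewrite (mmapC, mmapX) ?mmap1U.
have [[th1 [th1C th1X]] [th0 [th0C th0X]]] := (th_ex 'X_1, th_ex 0).
have : th1 (iota (h 1)) = th0 (iota (h 1)).
  rewrite hE !rmorph_mmap; apply: eq_mmap => [c|] /=; first by rewrite iotaC th1C th0C.
  apply: forall_ord3; rewrite /pt3 /= iota_h /coord_root /pt4 /=.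
  - by rewrite !rmorphXn th1X th0X.
  - rewrite !rmorphN !rmorphD !rmorphM !rmorphXn !th1X !th0X /pt3 /=.
    by rewrite expr0n gtn_eqF ?(ltnW m1) // !mul0r.
  - by rewrite !rmorphXn th1X th0X.
rewrite iota_h /coord_root /pt4 /= !rmorphXn th1X th0X /pt3 /= => /eqP.
rewrite expr0n gtn_eqF ?expn_gt0 ?p0 // expf_eq0 => /andP[_ /eqP].
by move/(congr1 (mcoeff U_(1))) => /eqP; rewrite mcoeffXU mcoeff0 eqxx oner_eq0.
Qed.

Theorem theorem3p8 (k : fieldType) (p m e s : nat) :
  p \in [pchar k] -> (0 < m)%N -> (0 < e)%N -> (0 < s)%N ->
  ~~ (p ^ e %| s * p)%N -> ~~ (s * p %| p ^ e)%N -> (1 < m)%N ->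
  ~ exists phi : {rmorphism hypA k p m e s -> {mpoly k[3]}},
      kalg_iso_quot_mpoly phi.
Proof.
move=> kp m0 e0 s0 nd1 nd2 m1 [phi [[g gK Kg] phiC]].
have p_pr := pcharf_prime kp.
have p1 := prime_gt1 p_pr; have p0 := prime_gt0 p_pr.
pose S := (s * p)%N; pose r := logn p S; pose q := (S`_p^')%N.
have S0 : (0 < S)%N by rewrite muln_gt0 s0.
have SE : S = (p ^ r * q)%N by rewrite -p_part partnC.
have r0 : (0 < r)%N by rewrite logn_gt0 mem_primes p_pr S0 dvdn_mull.
(* If [e <= r], then [p ^ e] divides s p. *)
have re : (r < e)%N.
  rewrite ltnNge; apply: contra nd1 => er; rewrite -/S SE dvdn_mulr //.
  exact: dvdn_exp2l.
have pq : ~~ (p %| q)%N by rewrite -p'natE // part_pnat.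
(* If q = 1, then s p is [p ^ r], which divides [p ^ e]. *)
have q1 : (1 < q)%N.
  rewrite ltn_neqAle part_gt0 andbT; apply: contra nd2 => /eqP q1.
  by rewrite -/S SE -q1 muln1 dvdn_exp2l // ltnW.
pose pi : {rmorphism {mpoly k[4]} -> hypA k p m e s} := \pi_(hypA k p m e s)%qT.
pose f : {rmorphism {mpoly k[4]} -> {mpoly k[3]}} := phi \o pi.
pose psi : {rmorphism {mpoly k[4]} -> {mpoly k[3]}} :=
  mmap (@mpolyC 3 k) (coord_root k (p ^ e) S m).
have f_surj a : exists b, a = f b.
  by exists (repr (g a)); rewrite /f /= reprK Kg.
pose h i := f 'X_i.
have psi_hyp : psi (hyp_poly k p m e s) = 0.
  rewrite /hyp_poly !rmorphD rmorphM !rmorphXn /= !mmapX !mmap1U.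
  exact: coord_root_relation.
have f_hyp : f (hyp_poly k p m e s) = 0.
  have : hyp_poly k p m e s \in @hyp_ideal k p m e s.
    by apply/hyp_idealP; exists 1; rewrite mul1r.
  rewrite -[X in X \in _]subr0 Quotient.idealrBE => /eqP e0'.
  by rewrite /f /= /pi /= e0' !rmorph0.
(* The kernel of [f] is the ideal of the hypersurface, and [psi] vanishes on it; thus [psi] factors
   through [f], which provides [iota]. *)
have ker b : f b = 0 -> psi b = 0.
  move=> /= fb; have : pi b = 0 by apply: (can_inj gK); rewrite fb rmorph0.
  rewrite -(rmorph0 pi) => /eqP; rewrite -Quotient.idealrBE subr0.
  by move=> /hyp_idealP[c ->]; rewrite rmorphM psi_hyp mulr0.
have [iota iotaE] := factor_morphism f_surj ker.
have fC c : f c%:MP = c%:MP by apply: phiC.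
have fE b : f b = mmap (@mpolyC 3 k) h b.
  rewrite {1}[b]mpolyE rmorph_sum; apply: eq_bigr => c _.
  rewrite -mul_mpolyC rmorphM fC mpolyXE_id rmorph_prod; congr (_ * _).
  by apply: eq_bigr => i _; rewrite rmorphXn.
have iotaC c : iota c%:MP = c%:MP by rewrite -[in LHS]fC iotaE; apply: mmapC.
have iota_h i : iota (h i) = coord_root k (p ^ e) S m i.
  by rewrite iotaE /psi /= mmapX mmap1U.
have h_rel : h 2 ^+ (p ^ e) = - (h 0 ^+ m * h 1 + h 3 ^+ S + h 3).
  apply/eqP; rewrite -subr_eq0 opprK; apply/eqP; rewrite -[RHS]f_hyp /hyp_poly.
  by rewrite !rmorphD rmorphM !rmorphXn; rewrite /h /S; ring.
apply: (generators_not_polynomial_ring kp m1 SE r0 re q1 pq iotaC iota_h h_rel) => a.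
by have [b ->] := f_surj a; exists b.
Qed.
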